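(* (i) For every $r\ge 0$, every $0<x<1$, every $n=0,1,2,\dots$ and every $0<a<1$, $$\frac{1}{(1+x)^{r+1}}\,\omega_{n,r+1}\!\left(\frac{-x}{1+x}\right)=\frac{(-1)^{n}}{2\pi i\,\Gamma(r+1)}\int_{a-i\infty}^{a+i\infty}x^{-s}s^{n}\,\Gamma(s)\,\Gamma(r+1-s)\,ds,$$ where the integration is on the vertical line $\{s=a+it:\ -\infty<t<+\infty\}$. (ii) For all $x>0$, $n=0,1,\dots$ and every $a>n+1$, $$\frac{e^{x}}{e^{x}-1}\,\omega_{n}\!\left(\frac{1}{e^{x}-1}\right)=\frac{1}{2\pi i}\int_{a-i\infty}^{a+i\infty}x^{-s}\,\zeta(s-n)\,\Gamma(s)\,ds.$$ (iii) For all $x>0$ and $n=1,2,3,\dots$, $$\frac{e^{x}}{e^{x}+1}\,\omega_{n}\!\left(\frac{-1}{e^{x}+1}\right)=(-1)^{n}\int_{0}^{\infty}\sin\!\left(xt+\frac{\pi n}{2}\right)\frac{t^{n}}{\sinh(\pi t)}\,dt,$$ $$\frac{e^{x}}{e^{x}-1}\,\omega_{n}\!\left(\frac{1}{e^{x}-1}\right)=\frac{n!}{x^{n+1}}+2(-1)^{n}\int_{0}^{\infty}\sin\!\left(xt+\frac{\pi n}{2}\right)\frac{t^{n}}{e^{2\pi t}-1}\,dt.$$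
   Context: $S(n,k)$ denotes the Stirling numbers of the second kind. For $r>0$ and $n=0,1,2,\dots$ the geometric polynomials are $\omega_{n,r}(x)=\frac{1}{\Gamma(r)}\sum_{k=0}^{n}S(n,k)\Gamma(k+r)x^{k}$, and $\omega_n(x)=\omega_{n,1}(x)=\sum_{k=0}^{n}S(n,k)\,k!\,x^{k}$. $\Gamma$ is the Gamma function and $\zeta$ is the Riemann zeta function.
   Formalization: In (ii) the printed formula fails for n = 0: the left side is e^x/(e^x-1) while the integral gives 1/(e^x-1); the formal statement adds the term 1 to the right side when n = 0 and is verbatim for n ≥ 1. *)

(* Defs.v *)
From HB Require Import structures.
From mathcomp Require Import all_boot all_order all_algebra.
From mathcomp Require Import all_classical all_reals all_analysis.
From mathcomp Require Import complex.

Set Implicit Arguments.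
Unset Strict Implicit.
Unset Printing Implicit Defensive.

Import Order.TTheory GRing.Theory Num.Theory.
Import numFieldNormedType.Exports.

Local Open Scope classical_set_scope.
Local Open Scope complex_scope.
Local Open Scope ring_scope.

(* The triangle S(0,0) = 1, S(n+1,0) = S(0,k+1) = 0,
   S(n+1,k+1) = (k+1) S(n,k+1) + S(n,k). *)
Fixpoint stirling2 (n k : nat) : nat :=
  match n, k with
  | 0, 0 => 1
  | 0, _.+1 => 0
  | _.+1, 0 => 0
  | n'.+1, k'.+1 => (k'.+1 * stirling2 n' k'.+1 + stirling2 n' k')%N
  end.

(* e^(u + iv) = e^u (cos v + i sin v) *)
Definition expC (R : realType) (z : R[i]) : R[i] :=
  (expR (complex.Re z) * cos (complex.Im z))
    +i* (expR (complex.Re z) * sin (complex.Im z)).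

(* x^s = exp(s ln x), meant for x > 0 only. *)
Definition cpow (R : realType) (x : R) (s : R[i]) : R[i] :=
  expC (s * (ln x)%:C).

Definition integrableC (R : realType) (D : set R) (f : R -> R[i]) : Prop :=
  (@lebesgue_measure R).-integrable D (EFin \o (fun t => complex.Re (f t))) /\
  (@lebesgue_measure R).-integrable D (EFin \o (fun t => complex.Im (f t))).

(* Meaningful when [integrableC D f]. *)
Definition integralC (R : realType) (D : set R) (f : R -> R[i]) : R[i] :=
  (Rintegral (@lebesgue_measure R) D (fun t => complex.Re (f t)))
    +i* (Rintegral (@lebesgue_measure R) D (fun t => complex.Im (f t))).

Definition vline_integrable (R : realType) (a : R) (f : R[i] -> R[i]) : Prop :=
  integrableC setT (fun t : R => f (a +i* t)).

(* On the line s = a + it one has ds = i dt. *)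
Definition vline_integral (R : realType) (a : R) (f : R[i] -> R[i]) : R[i] :=
  'i * integralC setT (fun t : R => f (a +i* t)).

(* Euler's integral; it is the Gamma function on the half-plane Re z > 0, the
   integral being absolutely convergent there.  No value is claimed elsewhere. *)
Definition GammaC (R : realType) (z : R[i]) : R[i] :=
  integralC `]0, +oo[ (fun t : R => cpow t (z - 1) * (expR (- t))%:C).

(* The restriction of the Gamma function to the reals r > 0. *)
Definition GammaR (R : realType) (r : R) : R :=
  Rintegral (@lebesgue_measure R) `]0, +oo[
    (fun t : R => t `^ (r - 1) * expR (- t)).

(* The Dirichlet series of the Riemann zeta function, convergent on the
   half-plane Re s > 1; no value is claimed elsewhere.  The limit is taken in
   the norm topology of R[i]. *)
Definition zetaC (R : realType) (s : R[i]) : R[i] :=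
  limn (fun N : nat => \sum_(1 <= k < N.+1) cpow k%:R (- s) : R[i]^o).

(* The geometric polynomial omega_(n,r), for r > 0. *)
Definition geom_poly (R : realType) (n : nat) (r : R) : {poly R} :=
  \poly_(k < n.+1) ((GammaR r)^-1 * ((stirling2 n k)%:R * GammaR (k%:R + r))).

Definition sinh (R : realType) (t : R) : R := (expR t - expR (- t)) / 2.

(* Main.v *)
Require Import Defs.
From HB Require Import structures.
From mathcomp Require Import all_boot all_order all_algebra.
From mathcomp Require Import all_classical all_reals all_analysis.
From mathcomp Require Import measurable_realfun complex.
From mathcomp Require Import ring lra.

(** Three classical ideas, one for each part.

The first two identities are Mellin-Barnes integrals, and both come from one
inversion formula: [mellin_inversion] recovers a nonnegative weight w on the
half-line from its Mellin transform on the imaginary axis, provided that this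
transform is absolutely integrable.  It is proved by damping the outer integral
by exp (- eps |t|), exchanging the integrals (which produces a Poisson kernel in
ln y), and letting eps tend to 0.  For w(y) = y^(a-1) e^(-y) the transform is
t |-> Gamma (a + it).  It is integrable because two uses of
Gamma (s+1) = s Gamma s, which is an integration by parts, bound it by a
constant times 1/(a^2 + t^2); no asymptotic expansion is involved.  The
inversion formula then gives [cahen_mellin], the integral of x^(-s) Gamma s,
and, after expanding the second Gamma factor as Euler's integral,
[Gamma_product], the integral of x^(-s) Gamma s Gamma (q + p - s).

For the Gamma-product identity, s^n Gamma s is rewritten by
[exprn_mul_GammaC] as an alternating combination of the Gamma (s + k) with
Stirling coefficients, and [Gamma_product] is applied to each k.  This yields
the coefficients of omega_(n,r+1).

For the zeta identity, zeta (s - n) is the sum of the k^(-s) k^n.  Termwise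
integration, justified by the absolute convergence of the series on the line,
turns it into the sum of the k^n e^(-kx).  Expanding k^n into falling
factorials sums this power series to a value of omega_n
([power_series_geom]).  The series starts at k = 1 whereas omega_n sums from
k = 0, whence the correction at n = 0.

For the real integrals, put z = 1/(e^x - 1) or z = -1/(e^x + 1).  Both satisfy
z' = - z (1 + z), and along every such z the functions (1 + z) omega_n(z) are
obtained from one another by the operator - d/dx ([is_derive_geom], which is the
Stirling recurrence).  The integrals of sin (xt + n pi/2) t^n w(t) have, up to
sign, the same property, so [geom_poly_osc_integral] reduces everything to
n = 0.  There the integrals of sin (xt) / (e^(ct) - 1) are needed for c = pi and
c = 2 pi; the geometric series and the Laplace transform of the sine turn
them into the partial fractions of coth ([mittag_leffler]), which are proved
without complex analysis by telescoping the quotients of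
int t sinh(zt) cos^n t and int cosh(zt) cos^n t over [0, pi/2]. *)

Set Implicit Arguments.
Unset Strict Implicit.
Unset Printing Implicit Defensive.

Import Order.TTheory GRing.Theory Num.Theory.
Import numFieldNormedType.Exports.

Local Open Scope classical_set_scope.
Local Open Scope complex_scope.
Local Open Scope ring_scope.

Local Notation leb R := (@lebesgue_measure R).
Local Notation integrableR D f := ((leb _).-integrable D (EFin \o f)).
Local Notation pos R := (`]0, +oo[%classic : set R).
Local Notation quarter R := (`[0, pi / 2]%classic : set R).

(** * Integration over the positive half-line *)

Lemma le_integrableR (R : realType) (D : set R) (f g : R -> R) :
  measurable D -> measurable_fun D f ->
  (forall x, D x -> `|f x| <= g x) -> integrableR D g -> integrableR D f.
Proof.
move=> mD mf fg; apply: le_integrable => //; first exact/measurable_EFinP.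
by move=> x Dx; rewrite /= lee_fin (le_trans (fg x Dx))// ler_norm.
Qed.

Lemma eq_integrableR (R : realType) (D : set R) (f g : R -> R) :
  measurable D -> (forall x, D x -> f x = g x) -> integrableR D f -> integrableR D g.
Proof.
by move=> mD fg; apply: eq_integrable => // x /[!inE] Dx; rewrite /= fg.
Qed.

Lemma integrableRZ (R : realType) (D : set R) (k : R) (f : R -> R) :
  measurable D -> integrableR D f -> integrableR D (fun x => k * f x).
Proof. by move=> mD fi; have := @integrableZl _ (measurableTypeR R) R (leb R) D mD k _ fi. Qed.

Lemma integrableRD (R : realType) (D : set R) (f g : R -> R) :
  measurable D -> integrableR D f -> integrableR D g ->
  integrableR D (fun x => f x + g x).
Proof. by move=> mD mf mg; exact: (@integrableD _ (measurableTypeR R) R (leb R) D mD _ _ mf mg). Qed.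

Lemma integrableRB (R : realType) (D : set R) (f g : R -> R) :
  measurable D -> integrableR D f -> integrableR D g ->
  integrableR D (fun x => f x - g x).
Proof. by move=> mD mf mg; exact: (@integrableB _ (measurableTypeR R) R (leb R) D mD _ _ mf mg). Qed.

Lemma measurable_integrableR (R : realType) (D : set R) (f : R -> R) :
  integrableR D f -> measurable_fun D f.
Proof. by move=> /measurable_int /measurable_EFinP. Qed.

Lemma in_itv0y (R : realType) (x : R) : (x \in `]0, +oo[) = (0 < x).
Proof. by rewrite in_itv/= andbT. Qed.

Lemma set_itv0y (R : realType) (x : R) : `]0, +oo[%classic x = (0 < x).
Proof. by rewrite /= in_itv0y. Qed.

(** The exhaustion by the segments [1/(n+2), n+2] reduces integrals over the
half-line to segments; the shift by 2 keeps each segment non-degenerate. *)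
Lemma itv0y_bigcup (R : realType) :
  `]0, +oo[%classic = \bigcup_n `[(n.+2%:R : R)^-1, n.+2%:R]%classic.
Proof.
apply/seteqP; split => [x|x [n _]] /=; rewrite !in_itv/= ?andbT.
- move=> x0; exists (maxn (Num.truncn x) (Num.truncn x^-1)) => //=.
  rewrite in_itv/=; apply/andP; split.
    rewrite -[leRHS]invrK lef_pV2 ?posrE ?invr_gt0//.
    apply: (le_trans (ltW (truncnS_gt _))); rewrite ler_nat.
    by rewrite ltnS leqW// (leq_maxr _ _).
  apply: (le_trans (ltW (truncnS_gt _))); rewrite ler_nat.
  by rewrite ltnS leqW// (leq_maxl _ _).
- by move=> /andP[+ _]; apply: lt_le_trans; rewrite invr_gt0.
Qed.

Lemma itv0y_exhaust_homo (R : realType) :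
  {homo (fun n : nat => `[(n.+2%:R : R)^-1, n.+2%:R]%classic) : n m / (n <= m)%N >-> (n <= m)%O}.
Proof.
move=> n m nm; apply/subsetPset => x /=; rewrite !in_itv/= => /andP[nx xn].
rewrite (le_trans _ nx) ?lef_pV2 ?posrE ?ler_nat ?ltnS//=.
by rewrite (le_trans xn)// ler_nat !ltnS.
Qed.

Lemma itv0y_exhaust_near (R : realType) (x : R) : 0 < x ->
  \forall n \near \oo, x \in `[(n.+2%:R : R)^-1, n.+2%:R].
Proof.
move=> x0.
have : `]0, +oo[%classic x by rewrite set_itv0y.
rewrite itv0y_bigcup => -[N _ Nx]; exists N => // n /= Nn.
by have /subsetPset := itv0y_exhaust_homo R Nn; exact.
Qed.

Lemma itv0y_exhaust_sub (R : realType) n :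
  `[(n.+2%:R : R)^-1, n.+2%:R]%classic `<=` `]0, +oo[%classic.
Proof. by rewrite itv0y_bigcup => x; exists n. Qed.

Lemma FTC_exhaust (R : realType) (f F : R -> R) n :
  (forall x : R, 0 < x -> {for x, continuous f}) ->
  (forall x : R, 0 < x -> is_derive x 1 F (f x)) ->
  (\int[leb R]_(x in `[((n.+2%:R : R)^-1)%R, n.+2%:R]) (f x)%:E)%E =
  (F n.+2%:R - F n.+2%:R^-1)%:E.
Proof.
move=> cf dF.
have n2 : 0 < (n.+2%:R : R)^-1 by rewrite invr_gt0.
have lt2 : (n.+2%:R : R)^-1 < n.+2%:R.
  by rewrite (@lt_trans _ _ 1) ?invf_lt1 ?ltr1n.
have cF x : 0 < x -> {for x, continuous F}.
  by move=> /dF[dFx _]; apply/differentiable_continuous/derivable1_diffP.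
rewrite (@continuous_FTC2 _ f F) ?EFinB//.
- apply: continuous_in_subspaceT => x; rewrite inE/= in_itv/= => /andP[x1 _].
  by apply: cf; rewrite (lt_le_trans n2).
- split.
  + move=> x; rewrite in_itv/= => /andP[x1 _].
    by have [] := dF x (lt_trans n2 x1).
  + by apply: cvg_at_right_filter; apply: cF.
  + by apply: cvg_at_left_filter; apply: cF; rewrite (lt_trans n2).
- move=> x; rewrite in_itv/= => /andP[x1 _].
  by rewrite derive1E; have [_ ->] := dF x (lt_trans n2 x1).
Qed.

Lemma measurable_in0y (R : realType) (f : R -> R) :
  (forall x : R, 0 < x -> {for x, continuous f}) -> measurable_fun (`]0, +oo[%classic : set R) f.
Proof.
move=> cf; apply: open_continuous_measurable_fun => //.
by move=> x; rewrite inE set_itv0y; exact: cf.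
Qed.

(** By monotone convergence along the exhaustion, the integral is the limit of
increments of F, each at most 2M. *)
Lemma integrable0y_bounded_primitive (R : realType) (f F : R -> R) (M : R) :
  (forall x : R, 0 < x -> 0 <= f x) ->
  (forall x : R, 0 < x -> {for x, continuous f}) ->
  (forall x : R, 0 < x -> is_derive x 1 F (f x)) ->
  (forall x : R, 0 < x -> `|F x| <= M) ->
  (leb R).-integrable `]0, +oo[ (EFin \o f).
Proof.
move=> f0 cf dF FM.
have mf := measurable_in0y cf.
apply/integrableP; split; first exact/measurable_EFinP.
have -> : (\int[leb R]_(x in `]0%R, +oo[) `|(EFin \o f) x| =
    \int[leb R]_(x in `]0%R, +oo[) (EFin \o f) x)%E.
  apply: eq_integral => x; rewrite inE set_itv0y => /f0 ?.
  by rewrite /= ger0_norm.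
apply: (@le_lt_trans _ _ (M + M)%:E); last exact: ltry.
rewrite itv0y_bigcup.
apply: (cvge_to_le (@ge0_nondecreasing_set_cvg_integral _ (measurableTypeR R) R
  _ (EFin \o f) (leb R) (@itv0y_exhaust_homo R) _ _ _)) => //.
- move=> i; apply/measurable_EFinP; apply: measurable_funS mf => //.
  exact: itv0y_exhaust_sub.
- by move=> i x /itv0y_exhaust_sub; rewrite set_itv0y lee_fin => /f0.
- apply: nearW => n; rewrite FTC_exhaust// lee_fin lerD//.
    exact: (le_trans (ler_norm _) (FM _ _)).
  by rewrite (le_trans (ler_norm _))// normrN FM// invr_gt0.
Qed.

Lemma Rdominated_cvg (R : realType) (D : set R) (f_ : nat -> R -> R) (f g : R -> R) :
  measurable D ->
  (forall n, measurable_fun D (f_ n)) ->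
  (forall x, D x -> f_ n x @[n --> \oo] --> f x) ->
  (leb R).-integrable D (EFin \o g) ->
  (forall n x, D x -> `|f_ n x| <= g x) ->
  (leb R).-integrable D (EFin \o f) /\
  Rintegral (leb R) D (f_ n) @[n --> \oo] --> Rintegral (leb R) D f.
Proof.
move=> mD mf_ cf ig dom.
have mf : measurable_fun D f by exact: (measurable_fun_cvg mf_ cf).
have intf : (leb R).-integrable D (EFin \o f).
  apply: le_integrable ig => //; first exact/measurable_EFinP.
  move=> x Dx /=; rewrite lee_fin.
  have fx : `|f_ n x| @[n --> \oo] --> `|f x| by apply: cvg_norm; exact: cf.
  apply: (@le_trans _ _ (g x)); last exact: ler_norm.
  by apply: (cvgr_to_le fx); apply: nearW => n; exact: dom.
split=> //; apply: fine_cvg.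
rewrite fineK; last exact: integrable_fin_num.
apply: (@dominated_cvg _ (measurableTypeR R) R (leb R) D mD (fun n => EFin \o f_ n) (EFin \o f) (EFin \o g)) => //.
- by move=> n; apply/measurable_EFinP; exact: mf_.
- by move=> x Dx; apply: cvg_EFin; [exact: nearW|exact: cf].
Qed.

(** For a signed integrand, integrability is an assumption and dominated
convergence replaces monotone convergence. *)
Lemma Rintegral_FTC0y (R : realType) (f F : R -> R) (l0 l : R) :
  (forall x : R, 0 < x -> {for x, continuous f}) ->
  (forall x : R, 0 < x -> is_derive x 1 F (f x)) ->
  (leb R).-integrable `]0, +oo[ (EFin \o f) ->
  F x @[x --> 0^'+] --> l0 -> F x @[x --> +oo] --> l ->
  Rintegral (leb R) `]0, +oo[ f = l - l0.
Proof.
move=> cf dF intf F0 Fy.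
have mf := measurable_in0y cf.
pose J n := `[(n.+2%:R : R)^-1, n.+2%:R]%classic.
have [_ cvgI] : (leb R).-integrable `]0, +oo[ (EFin \o f) /\
    Rintegral (leb R) `]0, +oo[ (f \_ (J n)) @[n --> \oo] --> Rintegral (leb R) `]0, +oo[ f.
  apply: (@Rdominated_cvg R _ _ _ (fun x => `|f x|)) => //.
  - move=> n; apply/measurable_restrict => //; first exact: measurable_itv.
    by apply: measurable_funS mf => // x [].
  - move=> x; rewrite set_itv0y => x0; apply: cvg_near_cst.
    near=> n; rewrite patchE ifT//; near: n.
    apply: filterS (itv0y_exhaust_near x0) => n.
    by rewrite inE.
  - exact: integrable_norm.
  - move=> n x x0; rewrite patchE; case: ifPn => // _.
    by rewrite normr0.
have E n : Rintegral (leb R) `]0, +oo[ (f \_ (J n)) = F n.+2%:R - F n.+2%:R^-1.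
  rewrite -Rintegral_mkcondr setIidr; last exact: itv0y_exhaust_sub.
  by rewrite /Rintegral FTC_exhaust.
have cvgF : F n.+2%:R - F (n.+2%:R : R)^-1 @[n --> \oo] --> l - l0.
  apply: cvgB.
    apply: ((cvg_pinftyP F l).1 Fy (fun n => n.+2%:R)).
    apply/cvgryPge => r; near=> n; apply: (@le_trans _ _ n%:R).
      by near: n; exact: nbhs_infty_ger.
    by rewrite ler_nat !leqW.
  apply: ((cvg_at_rightP F 0 l0).1 F0 (fun n => n.+2%:R^-1)); split.
    by move=> n; rewrite invr_gt0.
  by have := @cvg_harmonic R; rewrite -cvg_shiftS.
(* The integrals over the exhausting segments J n, extended by 0, are increments of F. *)
have {}E : (fun n => Rintegral (leb R) `]0, +oo[ (f \_ (J n))) =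
    (fun n => F n.+2%:R - F (n.+2%:R : R)^-1) by apply/funext.
rewrite E in cvgI.
by rewrite -(cvg_lim _ cvgI)//; exact: cvg_lim cvgF.
Unshelve. all: end_near. Qed.

(** * The substitution v = (ln y - b) / e *)

(** The substitution is made on each half-line [a_n, +oo[ with a_n = e^(-n), on
which the logarithm is regular up to the end point; both sides then converge
monotonically. *)
Lemma ge0_integral_ln_subst (R : realType) (b e : R) (G : R -> R) :
  0 < e -> continuous G -> (forall v, 0 <= G v) ->
  (\int[leb R]_v (G v)%:E =
   \int[leb R]_(y in `]0%R, +oo[) (G ((ln y - b) / e) / (e * y))%:E)%E.
Proof.
move=> e0 cG G0.
pose a n : R := expR (- n%:R).
pose F y : R := (ln y - b) / e.
have a0 n : 0 < a n by exact: expR_gt0.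
have dF (y : R) : 0 < y -> is_derive y 1 F (e * y)^-1.
  move=> y0; have ? := is_derive1_ln y0.
  rewrite /F; apply: is_derive_eq.
  by rewrite scaler0 add0r subr0 invfM.
have dFE (y : R) : 0 < y -> F^`()%classic y = (e * y)^-1.
  by move=> y0; rewrite derive1E; have [_ ->] := dF y y0.
have cont_inv (y : R) : 0 < y -> {for y, continuous (fun y => (e * y)^-1)}.
  move=> y0; apply: cvgV; first by rewrite mulf_neq0 ?gt_eqF.
  by apply: cvgM; [exact: cvg_cst|exact: cvg_id].
have near0 (y : R) : 0 < y -> \forall z \near y, 0 < z.
  by move=> y0; exact: lt_nbhsr.
have I n : (\int[leb R]_(v in `[F (a n), +oo[) (G v)%:E =
    \int[leb R]_(y in `[a n, +oo[) (G ((ln y - b) / e) / (e * y))%:E)%E.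
  rewrite increasing_ge0_integration_by_substitutiony.
  - apply: eq_integral => y; rewrite inE/= in_itv/= andbT => ay.
    by rewrite /= fctE dFE// (lt_le_trans (a0 n)).
  - move=> x y; rewrite !in_itv/= !andbT => ax ay xy.
    rewrite /F ltr_pM2r ?invr_gt0// ltrD2r ltr_ln ?posrE//.
      exact: (lt_le_trans (a0 n)).
    exact: (lt_le_trans (a0 n)).
  - move=> y; rewrite in_itv/= andbT => ay.
    have y0 : 0 < y by exact: (lt_trans (a0 n)).
    rewrite /continuous_at dFE//; apply: cvg_trans (cont_inv y y0).
    apply: near_eq_cvg; by apply: filterS (near0 y y0) => z z0; rewrite dFE.
  - apply/cvg_ex; exists (e * a n)^-1.
    apply: cvg_trans (cvg_at_right_filter (cont_inv _ (a0 n))).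
    apply: near_eq_cvg; near=> z; rewrite dFE//.
    by apply: (lt_trans (a0 n)); near: z; exact: nbhs_right_gt.
  - apply/cvg_ex; exists 0.
    have F'0 : (e * x)^-1 @[x --> +oo] --> (0 : R).
      apply/(@gtr0_cvgV0 _ _ _ _ (fun x => e * x)).
        by near=> y; rewrite mulr_gt0//; near: y; exact: nbhs_pinfty_gt.
      by apply: gt0_cvgMry => //; exact: cvg_id.
    apply: cvg_trans F'0; apply: near_eq_cvg.
    have : \forall z \near +oo, (0 : R) < z by exact: nbhs_pinfty_gt.
    by apply: filterS => z z0; rewrite dFE.
  - split.
      move=> y; rewrite in_itv/= andbT => ay.
      by have [] := dF y (lt_trans (a0 n) ay).
    apply: cvg_at_right_filter; apply/differentiable_continuous/derivable1_diffP.
    by have [] := dF _ (a0 n).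
  - apply/cvgryPge => r.
    have : \forall y \near +oo, expR (r * e + b) <= y.
      by apply: nbhs_pinfty_ge; exact: num_real.
    apply: filterS => y ry; have y0 : 0 < y by exact: (lt_le_trans (expR_gt0 _) ry).
    by rewrite /F ler_pdivlMr// lerBrDr -ler_expR lnK ?posrE.
  - exact: continuous_subspaceT.
  - by move=> v _; exact: G0.
have mh : measurable_fun (`]0, +oo[%classic : set R) (fun y => G ((ln y - b) / e) / (e * y)).
  apply: measurable_in0y => y y0; apply: cvgM; last exact: cont_inv.
  apply: (@continuous_comp _ _ _ F G); last exact: cG.
  apply/differentiable_continuous/derivable1_diffP.
  by have [] := dF _ y0.
have aN m n : (n <= m)%N -> a m <= a n by move=> nm; rewrite ler_expR lerN2 ler_nat.
have A : (\int[leb R]_(v in `[F (a n), +oo[) (G v)%:E @[n --> \oo] -->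
    \int[leb R]_v (G v)%:E)%E.
  have -> : [set: R] = \bigcup_n `[F (a n), +oo[%classic.
    apply/seteqP; split => // v _.
    exists (Num.truncn (- (b + e * v))).+1 => //=.
    rewrite in_itv/= andbT /F expRK ler_pdivrMr// lerBlDr lerNl.
    rewrite (le_trans _ (ltW (truncnS_gt _)))//.
    by rewrite addrC mulrC.
  apply: (@ge0_nondecreasing_set_cvg_integral _ (measurableTypeR R) R
    _ (EFin \o G) (leb R)).
  - move=> m n mn; apply/subsetPset => v /=; rewrite !in_itv/= !andbT.
    apply: le_trans; rewrite /F ler_pM2r ?invr_gt0// lerD2r ler_ln ?posrE//.
    exact: aN.
  - by move=> n; exact: measurable_itv.
  - move=> n; apply/measurable_EFinP/measurable_funTS.
    exact: continuous_measurable_fun.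
  - by move=> n v _; rewrite lee_fin.
have B : (\int[leb R]_(y in `[a n, +oo[) (G ((ln y - b) / e) / (e * y))%:E @[n --> \oo] -->
    \int[leb R]_(y in `]0%R, +oo[) (G ((ln y - b) / e) / (e * y))%:E)%E.
  have U : `]0, +oo[%classic = \bigcup_n `[a n, +oo[%classic.
    apply/seteqP; split => [v|v [n _]] /=; rewrite !in_itv/= !andbT => v0.
      exists (Num.truncn (- ln v)).+1 => //=.
      rewrite in_itv/= andbT -[leRHS]lnK ?posrE// ler_expR lerNl.
      by rewrite (le_trans _ (ltW (truncnS_gt _))).
    exact: (lt_le_trans (a0 n)).
  rewrite U.
  apply: (@ge0_nondecreasing_set_cvg_integral _ (measurableTypeR R) R
    _ (EFin \o (fun y => G ((ln y - b) / e) / (e * y))) (leb R)).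
  - move=> m n mn; apply/subsetPset => v /=; rewrite !in_itv/= !andbT.
    by apply: le_trans; exact: aN.
  - by move=> n; exact: measurable_itv.
  - move=> n; apply/measurable_EFinP; apply: measurable_funS mh => //.
    by rewrite U => v; exists n.
  - move=> n v /=; rewrite in_itv/= andbT lee_fin => av.
    by rewrite divr_ge0// mulr_ge0// ltW// (lt_le_trans _ av).
rewrite -(cvg_lim _ A)// -(cvg_lim _ B)//.
by congr (lim _); under eq_fun do rewrite I.
Unshelve. all: end_near. Qed.

(** * The weights y^(p-1) e^(-cy) and Euler's integral *)

(** For c = 1 the integrand of Euler's integral for Gamma p; the scale c is what
the product formula for Gamma needs. *)
Definition pow_exp (R : realType) (p c y : R) : R := y `^ (p - 1) * expR (- (c * y)).

Lemma powRE_gt0 (R : realType) (y q : R) : 0 < y -> y `^ q = expR (q * ln y).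
Proof. by move=> y0; rewrite /powR gt_eqF. Qed.

(** The bound is the maximum, attained at y = q/c; it follows from ln u <= u - 1
at u = c y / q. *)
Lemma powR_expR_bounded (R : realType) (q c : R) : 0 < q -> 0 < c ->
  exists2 K, 0 < K & forall y : R, 0 < y -> y `^ q * expR (- (c * y)) <= K.
Proof.
move=> q0 c0; exists (expR (q * ln (q / c) - q)); first exact: expR_gt0.
move=> y y0; rewrite powRE_gt0// -expRD ler_expR.
have z0 : 0 < c * y / q by rewrite divr_gt0// mulr_gt0.
have H : ln (c * y / q) <= c * y / q - 1.
  rewrite -{1}(subrKC 1 (c * y / q)) le_ln1Dx//.
  by rewrite ltrBrDl subrr.
have E : ln y = ln (c * y / q) + ln (q / c).
  rewrite -lnM ?posrE ?divr_gt0 ?mulr_gt0//.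
  have -> // : c * y / q * (q / c) = y by field; rewrite !gt_eqF.
rewrite E mulrDr.
have : q * ln (c * y / q) <= q * (c * y / q - 1) by rewrite ler_pM2l.
have -> : q * (c * y / q - 1) = c * y - q by field; rewrite gt_eqF.
by move=> ?; lra.
Qed.

Lemma continuous_powR_gt0 (R : realType) (q y : R) : 0 < y ->
  {for y, continuous (fun y : R => y `^ q)}.
Proof.
move=> y0; apply/differentiable_continuous/derivable1_diffP.
by have [] := is_derive1_powR q y0.
Qed.

Lemma continuous_pow_exp (R : realType) (p c y : R) : 0 < y ->
  {for y, continuous (pow_exp p c)}.
Proof.
move=> y0; apply: cvgM; first exact: continuous_powR_gt0.
apply: continuous_comp; last exact: continuous_expR.
by apply: cvgN; apply: cvgM; [exact: cvg_cst|exact: cvg_id].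
Qed.

Lemma measurable_pow_exp (R : realType) (p c : R) :
  measurable_fun setT (pow_exp p c).
Proof.
apply: measurable_funM; first exact: measurable_powR.
apply: measurableT_comp; first exact: measurable_expR.
by apply: measurableT_comp => //; exact: measurable_funM.
Qed.

Lemma pow_exp_ge0 (R : realType) (p c y : R) : 0 <= pow_exp p c y.
Proof. by rewrite mulr_ge0 ?powR_ge0 ?expR_ge0. Qed.

(** The weight is compared with y^(p-1) / (1 + y^p)^2, whose primitive
-1/(p (1 + y^p)) is bounded on the whole half-line; this treats the possible
singularity at 0 and the behaviour at infinity together. *)
Lemma integrable_pow_exp (R : realType) (p c : R) : 0 < p -> 0 < c ->
  integrableR (`]0, +oo[%classic : set R) (pow_exp p c).
Proof.
move=> p0 c0.
pose g (y : R) : R := y `^ (p - 1) / (1 + y `^ p) ^+ 2.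
pose G (y : R) : R := - (p^-1 / (1 + y `^ p)).
have D0 (y : R) : 0 < 1 + y `^ p by rewrite ltr_pwDl// powR_ge0.
have ig : integrableR (`]0, +oo[%classic : set R) g.
  apply: (@integrable0y_bounded_primitive _ g G p^-1).
  - by move=> y y0; rewrite divr_ge0 ?powR_ge0// exprn_ge0// ltW.
  - move=> y y0; apply: cvgM; first exact: continuous_powR_gt0.
    apply: cvgV; first by rewrite gt_eqF// exprn_gt0.
    apply: (@continuous_comp _ _ _ (fun y => 1 + y `^ p) (fun z => z ^+ 2));
      last exact: exprn_continuous.
    by apply: cvgD; [exact: cvg_cst|exact: continuous_powR_gt0].
  - move=> y y0; have ? := is_derive1_powR p y0.
    have ? : 1 + y `^ p != 0 by rewrite gt_eqF.
    rewrite /G; apply: is_derive_eq.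
    rewrite /g /GRing.scale/=; field.
    by rewrite gt_eqF//= gt_eqF.
  - move=> y y0; rewrite normrN ger0_norm; last first.
      by rewrite divr_ge0 ?invr_ge0 ?(ltW p0) ?(ltW (D0 y)).
    by rewrite ler_pdivrMr// ler_peMr ?invr_ge0 ?(ltW p0)// lerDl powR_ge0.
have [K K0 HK] : exists2 K, 0 < K & forall y : R, 0 < y -> y `^ (2 * p) * expR (- (c * y)) <= K.
  by apply: powR_expR_bounded => //; rewrite mulr_gt0.
apply: (le_integrableR _ _ _ (@integrableRZ _ _ (2 + 2 * K) _ _ ig)) => //.
  by apply/measurable_funTS; exact: measurable_pow_exp.
move=> y; rewrite set_itv0y => y0; rewrite ger0_norm ?pow_exp_ge0//.
rewrite /g mulrCA /pow_exp ler_wpM2l ?powR_ge0// ler_pdivlMr ?exprn_gt0//.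
have E1 : expR (- (c * y)) <= 1 by rewrite expR_le1 oppr_le0 mulr_ge0 ?ltW.
have := HK y y0.
rewrite [2 * p]mulrC powRrM powR_mulrn ?powR_ge0// [X in X <= K -> _]mulrC => HK1.
have E0 := expR_gt0 (- (c * y)).
set E := expR _ in E1 E0 HK1 *; set u := y `^ p in HK1 *.
have : E * (1 + u) ^+ 2 <= E * (2 + 2 * u ^+ 2).
  rewrite ler_pM2l//; have := sqr_ge0 (u - 1); nra.
by nra.
Qed.

(** Both integrals become the integral of e^(pv) e^(-e^v) over the line, by
v = ln (c y) and by v = ln y. *)
Lemma Rintegral_pow_exp (R : realType) (p c : R) : 0 < p -> 0 < c ->
  Rintegral (leb R) `]0, +oo[ (pow_exp p c) = c `^ (- p) * GammaR p.
Proof.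
move=> p0 c0.
pose G (v : R) := expR (p * v) * expR (- expR v).
have cG : continuous G.
  move=> v; apply: cvgM; (apply: continuous_comp; last exact: continuous_expR).
    by apply: cvgM; [exact: cvg_cst|exact: cvg_id].
  by apply: cvgN; exact: continuous_expR.
have G0 v : 0 <= G v by rewrite mulr_ge0// expR_ge0.
have GE (k y : R) : 0 < k -> 0 < y ->
    G ((ln y - ln k^-1) / 1) / (1 * y) = k `^ p * pow_exp p k y.
  move=> k0 y0; rewrite divr1 mul1r lnV ?posrE// opprK -lnM ?posrE//.
  rewrite /G lnK ?posrE ?mulr_gt0// -powRE_gt0 ?mulr_gt0//.
  rewrite powRM ?ltW// /pow_exp (mulrC y k).
  have -> : y `^ (p - 1) = y `^ p / y.
    by rewrite powRB ?powRr1 ?(ltW y0)// (gt_eqF y0) implybT.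
  by field; rewrite gt_eqF.
have H (k : R) : 0 < k -> fine (\int[leb R]_v (G v)%:E)%E =
    k `^ p * Rintegral (leb R) `]0, +oo[ (pow_exp p k).
  move=> k0; rewrite (@ge0_integral_ln_subst _ (ln k^-1) 1)//.
  rewrite -RintegralZl//; last exact: integrable_pow_exp.
  by apply: eq_Rintegral => y; rewrite inE set_itv0y => y0; rewrite GE.
have ck : c `^ p != 0 by rewrite gt_eqF// powR_gt0.
(* By H both integrals equal the one of G, so their scaled values agree for k = c and k = 1. *)
apply: (mulfI ck); rewrite -(H c c0) mulrA -powRD ?(gt_eqF c0) ?implybT//.
rewrite subrr powRr0 mul1r (H 1 ltr01) powR1 mul1r.
by apply: eq_Rintegral => y _; rewrite /pow_exp mul1r.
Qed.

Lemma GammaR_pow_exp (R : realType) (p : R) :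
  GammaR p = Rintegral (leb R) `]0, +oo[ (pow_exp p 1).
Proof. by apply: eq_Rintegral => y _; rewrite /pow_exp mul1r. Qed.

(** * Fubini for integrands dominated by a product *)

Lemma RintegralE_EFin (R : realType) (D : set R) (f : R -> R) :
  measurable D -> integrableR D f ->
  (\int[leb R]_(x in D) (f x)%:E)%E = (Rintegral (leb R) D f)%:E.
Proof. by move=> mD fi; rewrite /Rintegral fineK//; exact: integrable_fin_num. Qed.

Lemma Rintegral_FubiniT (R : realType) (f : R * R -> R) (h k : R -> R) :
  measurable_fun setT f -> integrableR setT h -> integrableR setT k ->
  (forall x y, `|f (x, y)| <= h x * k y) ->
  Rintegral (leb R) setT (fun x => Rintegral (leb R) setT (fun y => f (x, y))) =
  Rintegral (leb R) setT (fun y => Rintegral (leb R) setT (fun x => f (x, y))).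
Proof.
move=> mf ih ik fhk.
have mT : measurable (setT : set R) by [].
have sec1 x : integrableR setT (fun y => f (x, y)).
  apply: (le_integrableR _ _ _ (@integrableRZ R setT (h x) k _ ik)) => //.
  exact: measurable_fun_pair2.
have sec2 y : integrableR setT (fun x => f (x, y)).
  apply: (le_integrableR _ _ _ (@integrableRZ R setT (k y) h _ ih)) => //.
    exact: measurable_fun_pair1.
  by move=> x _; rewrite mulrC.
have mEf : measurable_fun setT (EFin \o f) by exact/measurable_EFinP.
have If : ((leb R) \x (leb R))%E.-integrable setT (EFin \o f).
  apply/integrable12ltyP => //.
  pose K := Rintegral (leb R) setT (fun y => `|k y|).
  apply: (@le_lt_trans _ _ (\int[leb R]_x (K * `|h x|)%:E)%E).
    apply: ge0_le_integral => //.
    - by move=> x _; exact: integral_ge0.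
    - apply: (@measurable_fun_fubini_tonelli_F _ _ _ _ _ (leb R) (abse \o (EFin \o f))) => //.
        exact: measurableT_comp.
      by move=> z; rewrite /= lee_fin.
    - apply/measurable_EFinP/measurable_funM => //.
      by apply: measurableT_comp => //; exact: measurable_integrableR ih.
    move=> x _ /=.
    apply: (@le_trans _ _ (\int[leb R]_y (`|h x| * `|k y|)%:E)%E).
      apply: ge0_le_integral => //=.
      + by apply/measurable_EFinP/measurableT_comp => //; exact: measurable_fun_pair2.
      + apply/measurable_EFinP/measurable_funM => //.
        by apply: measurableT_comp => //; exact: measurable_integrableR ik.
      + by move=> y _; rewrite lee_fin -normrM (le_trans (fhk x y))// ler_norm.
    rewrite RintegralE_EFin//.
      by rewrite RintegralZl ?integrable_norm// lee_fin mulrC.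
    by apply: integrableRZ => //; exact: integrable_norm.
  rewrite RintegralE_EFin ?ltry//.
  by apply: integrableRZ => //; exact: integrable_norm.
have := Fubini If.
under [X in X = _ -> _]eq_integral do rewrite /= RintegralE_EFin//.
under [X in _ = X -> _]eq_integral do rewrite /= RintegralE_EFin//.
by rewrite /Rintegral => ->.
Qed.

Lemma Rintegral_indic (R : realType) (D : set R) (f : R -> R) :
  Rintegral (leb R) D f = Rintegral (leb R) setT (fun x => f x * \1_D x).
Proof. by rewrite Rintegral_mkcond patch_indic. Qed.

Lemma integrableR_indic (R : realType) (D : set R) (f : R -> R) : measurable D ->
  integrableR D f <-> integrableR setT (fun x => f x * \1_D x).
Proof.
move=> mD; rewrite (_ : (fun x => _) = f \_ D); last by rewrite patch_indic.
by rewrite -restrict_EFin; exact: integrable_mkcond.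
Qed.

(** Domination by a product of integrable functions gives integrability on the
product space; the general case is the case of the whole line after
multiplication by indicator functions. *)
Lemma Rintegral_Fubini (R : realType) (D E : set R) (f : R * R -> R) (h k : R -> R) :
  measurable D -> measurable E ->
  measurable_fun setT f -> integrableR D h -> integrableR E k ->
  (forall x y, D x -> E y -> `|f (x, y)| <= h x * k y) ->
  Rintegral (leb R) D (fun x => Rintegral (leb R) E (fun y => f (x, y))) =
  Rintegral (leb R) E (fun y => Rintegral (leb R) D (fun x => f (x, y))).
Proof.
move=> mD mE mf ih ik fhk.
pose g (z : R * R) := f z * \1_D z.1 * \1_E z.2.
have mg : measurable_fun setT g.
  apply: measurable_funM; [apply: measurable_funM => //|];
    by apply: measurableT_comp => //; exact: measurable_indic.
have H := @Rintegral_FubiniT R g _ _ mg ((integrableR_indic h mD).1 ih)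
  ((integrableR_indic k mE).1 ik).
transitivity (Rintegral (leb R) setT (fun x => Rintegral (leb R) setT (fun y => g (x, y)))).
  rewrite Rintegral_indic; apply: eq_Rintegral => x _.
  rewrite indicE; have [Dx|Dx] := boolP (x \in D).
    rewrite mulr1 Rintegral_indic; apply: eq_Rintegral => y _.
    by rewrite /g/= !indicE Dx mulr1.
  rewrite mulr0 (@eq_Rintegral _ _ _ _ _ (cst 0)) ?Rintegral_cst ?mul0r//.
  by move=> y _; rewrite /g/= !indicE (negbTE Dx) mulr0 mul0r.
rewrite H; last first.
  move=> x y; rewrite /g/= !indicE.
  have [|] := boolP (x \in D); have [|] := boolP (y \in E);
    rewrite ?(mulr0, mul0r, mulr1) ?normr0//.
  by rewrite !inE => Ey Dx; exact: fhk.
rewrite [RHS]Rintegral_indic; apply: eq_Rintegral => y _.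
rewrite indicE; have [Ey|Ey] := boolP (y \in E).
  rewrite mulr1 [RHS]Rintegral_indic; apply: eq_Rintegral => x _.
  by rewrite /g/= !indicE Ey mulr1.
rewrite mulr0 (@eq_Rintegral _ _ _ _ _ (cst 0)) ?Rintegral_cst ?mul0r//.
by move=> x _; rewrite /g/= !indicE (negbTE Ey) mulr0.
Qed.

(** * Complex-valued integrals *)

(** Measurability componentwise, to match the componentwise definition of the
complex integral. *)
Definition cmeasurable d (T : measurableType d) (R : realType) (D : set T) (f : T -> R[i]) :=
  measurable_fun D (fun x => complex.Re (f x)) /\
  measurable_fun D (fun x => complex.Im (f x)).

Lemma creM (R : realType) (z w : R[i]) :
  complex.Re (z * w) = complex.Re z * complex.Re w - complex.Im z * complex.Im w.
Proof. by case: z; case: w. Qed.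

Lemma cimM (R : realType) (z w : R[i]) :
  complex.Im (z * w) = complex.Re z * complex.Im w + complex.Im z * complex.Re w.
Proof. by case: z; case: w. Qed.

Lemma creD (R : realType) (z w : R[i]) : complex.Re (z + w) = complex.Re z + complex.Re w.
Proof. by case: z; case: w. Qed.

Lemma cimD (R : realType) (z w : R[i]) : complex.Im (z + w) = complex.Im z + complex.Im w.
Proof. by case: z; case: w. Qed.

Lemma complex_ext (R : realType) (z w : R[i]) :
  complex.Re z = complex.Re w -> complex.Im z = complex.Im w -> z = w.
Proof. by case: z; case: w => a b c d /= -> ->. Qed.

Lemma normc_ge_absRe (R : realType) (z : R[i]) : `|complex.Re z| <= Normc.normc z.
Proof.
case: z => a b /=; rewrite -sqrtr_sqr ler_sqrt ?lerDl ?sqr_ge0//.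
by rewrite addr_ge0 ?sqr_ge0.
Qed.

Lemma normc_ge_absIm (R : realType) (z : R[i]) : `|complex.Im z| <= Normc.normc z.
Proof.
case: z => a b /=; rewrite -sqrtr_sqr ler_sqrt ?lerDr ?sqr_ge0//.
by rewrite addr_ge0 ?sqr_ge0.
Qed.

Lemma normc_le_absD (R : realType) (z : R[i]) :
  Normc.normc z <= `|complex.Re z| + `|complex.Im z|.
Proof.
case: z => a b /=; rewrite -[leRHS]ger0_norm ?addr_ge0// -sqrtr_sqr.
rewrite ler_sqrt ?sqr_ge0// sqrrD !real_normK ?num_real// addrAC lerDl.
by rewrite mulrn_wge0// mulr_ge0.
Qed.

Lemma normc_ge0 (R : realType) (z : R[i]) : 0 <= Normc.normc z.
Proof. by apply: le_trans (normc_ge_absRe z). Qed.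

Lemma normc_real (R : realType) (x : R) : Normc.normc x%:C = `|x|.
Proof. by rewrite /= expr0n/= addr0 sqrtr_sqr. Qed.

Section cmeasurable.
Context d (T : measurableType d) (R : realType) (D : set T).
Implicit Types f g : T -> R[i].

Lemma cmeasurable_real (f : T -> R) : measurable_fun D f -> cmeasurable D (fun x => (f x)%:C).
Proof. by move=> mf; split => //=; exact: measurable_cst. Qed.

Lemma cmeasurableM f g : cmeasurable D f -> cmeasurable D g ->
  cmeasurable D (fun x => f x * g x).
Proof.
move=> [f1 f2] [g1 g2]; split.
  by under eq_fun do rewrite creM; apply: measurable_funB; apply: measurable_funM.
by under eq_fun do rewrite cimM; apply: measurable_funD; apply: measurable_funM.
Qed.

End cmeasurable.

Section integralC.
Context (R : realType) (D : set R) (mD : measurable D).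
Implicit Types f g : R -> R[i].

Lemma integrableC_measurable f : integrableC D f -> cmeasurable D f.
Proof. by move=> [f1 f2]; split; apply: measurable_integrableR. Qed.

Lemma le_integrableC f (g : R -> R) : cmeasurable D f ->
  (forall x, D x -> Normc.normc (f x) <= g x) -> integrableR D g -> integrableC D f.
Proof.
move=> [f1 f2] fg ig; split; apply: (le_integrableR mD _ _ ig) => // x Dx.
  exact: le_trans (normc_ge_absRe _) (fg x Dx).
exact: le_trans (normc_ge_absIm _) (fg x Dx).
Qed.

Lemma eq_integrableC f g : (forall x, D x -> f x = g x) -> integrableC D f -> integrableC D g.
Proof.
by move=> fg [f1 f2]; split; [apply: eq_integrableR f1 => // x Dx|
  apply: eq_integrableR f2 => // x Dx]; rewrite fg.
Qed.

Lemma eq_integralC f g : (forall x, D x -> f x = g x) -> integralC D f = integralC D g.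
Proof.
move=> fg; congr (_ +i* _); apply: eq_Rintegral => x; rewrite inE => Dx;
  by rewrite fg.
Qed.

Lemma integrableCZ c f : integrableC D f -> integrableC D (fun x => c * f x).
Proof.
move=> [f1 f2]; split.
  apply: (eq_integrableR mD _ (integrableRB mD
    (integrableRZ (complex.Re c) mD f1) (integrableRZ (complex.Im c) mD f2))).
  by move=> x _; rewrite creM.
apply: (eq_integrableR mD _ (integrableRD mD
    (integrableRZ (complex.Re c) mD f2) (integrableRZ (complex.Im c) mD f1))).
by move=> x _; rewrite cimM.
Qed.

Lemma integralCZ c f : integrableC D f -> integralC D (fun x => c * f x) = c * integralC D f.
Proof.
move=> [f1 f2]; apply: complex_ext; rewrite ?creM ?cimM /=.
  under eq_Rintegral do rewrite creM.
  by rewrite RintegralB ?RintegralZl//; exact: integrableRZ.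
under eq_Rintegral do rewrite cimM.
by rewrite RintegralD ?RintegralZl//; exact: integrableRZ.
Qed.

Lemma integrableCD f g : integrableC D f -> integrableC D g -> integrableC D (fun x => f x + g x).
Proof.
move=> [f1 f2] [g1 g2]; split.
  by apply: (eq_integrableR mD _ (integrableRD mD f1 g1)) => x _; rewrite creD.
by apply: (eq_integrableR mD _ (integrableRD mD f2 g2)) => x _; rewrite cimD.
Qed.

Lemma integralCD f g : integrableC D f -> integrableC D g ->
  integralC D (fun x => f x + g x) = integralC D f + integralC D g.
Proof.
move=> [f1 f2] [g1 g2]; apply: complex_ext; rewrite ?creD ?cimD /=.
  by under eq_Rintegral do rewrite creD; rewrite RintegralD.
by under eq_Rintegral do rewrite cimD; rewrite RintegralD.
Qed.

Lemma integrableC0 : integrableC D (fun=> 0 : R[i]).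
Proof. by split; exact: integrable0. Qed.

Lemma integralC0 : integralC D (fun=> 0 : R[i]) = 0.
Proof. by apply: complex_ext; rewrite /= Rintegral_cst ?mul0r. Qed.

Lemma integrableC_sum (I : Type) (s : seq I) (f : I -> R -> R[i]) :
  (forall i, integrableC D (f i)) -> integrableC D (fun x => \sum_(i <- s) f i x).
Proof.
move=> fi; elim: s => [|i s ih].
  by apply: eq_integrableC integrableC0 => x _; rewrite big_nil.
by apply: eq_integrableC (integrableCD (fi i) ih) => x _; rewrite big_cons.
Qed.

Lemma integralC_sum (I : Type) (s : seq I) (f : I -> R -> R[i]) :
  (forall i, integrableC D (f i)) ->
  integralC D (fun x => \sum_(i <- s) f i x) = \sum_(i <- s) integralC D (f i).
Proof.
move=> fi; elim: s => [|i s ih].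
  by rewrite big_nil -[RHS]integralC0; apply: eq_integralC => x _; rewrite big_nil.
rewrite big_cons -ih -integralCD//; last exact: integrableC_sum.
by apply: eq_integralC => x _; rewrite big_cons.
Qed.

(** Convergence componentwise; it agrees with the norm topology, see
[cvgC_limn]. *)
Definition cvgC (u : nat -> R[i]) (l : R[i]) :=
  complex.Re (u n) @[n --> \oo] --> complex.Re l /\
  complex.Im (u n) @[n --> \oo] --> complex.Im l.

Lemma dominated_cvgC (f_ : nat -> R -> R[i]) f (g : R -> R) :
  (forall n, cmeasurable D (f_ n)) ->
  (forall x, D x -> cvgC (f_ ^~ x) (f x)) ->
  integrableR D g ->
  (forall n x, D x -> Normc.normc (f_ n x) <= g x) ->
  integrableC D f /\ cvgC (fun n => integralC D (f_ n)) (integralC D f).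
Proof.
move=> mf_ ff ig fg.
have [i1 c1] := Rdominated_cvg mD (fun n => (mf_ n).1) (fun x Dx => (ff x Dx).1) ig
  (fun n x Dx => le_trans (normc_ge_absRe _) (fg n x Dx)).
have [i2 c2] := Rdominated_cvg mD (fun n => (mf_ n).2) (fun x Dx => (ff x Dx).2) ig
  (fun n x Dx => le_trans (normc_ge_absIm _) (fg n x Dx)).
by split; split.
Qed.

End integralC.

Lemma cvgC_unique (R : realType) (u : nat -> R[i]) (l l' : R[i]) :
  cvgC u l -> cvgC u l' -> l = l'.
Proof.
move=> [u1 u2] [v1 v2]; apply: complex_ext.
  by rewrite -(cvg_lim _ u1)//; exact: cvg_lim v1.
by rewrite -(cvg_lim _ u2)//; exact: cvg_lim v2.
Qed.

Lemma integralC_Fubini (R : realType) (D E : set R) (f : R -> R -> R[i]) (h k : R -> R) :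
  measurable D -> measurable E ->
  cmeasurable setT (fun z : R * R => f z.1 z.2) ->
  integrableR D h -> integrableR E k ->
  (forall x y, D x -> E y -> Normc.normc (f x y) <= h x * k y) ->
  integralC D (fun x => integralC E (f x)) =
  integralC E (fun y => integralC D (f ^~ y)).
Proof.
move=> mD mE [m1 m2] ih ik fhk; apply: complex_ext; rewrite /integralC.
  apply: (Rintegral_Fubini mD mE m1 ih ik) => x y Dx Ey /=.
  exact: le_trans (normc_ge_absRe _) (fhk x y Dx Ey).
apply: (Rintegral_Fubini mD mE m2 ih ik) => x y Dx Ey /=.
exact: le_trans (normc_ge_absIm _) (fhk x y Dx Ey).
Qed.

(** * Gamma on a vertical line as a Mellin transform *)

Definition cis (R : realType) (x : R) : R[i] := cos x +i* sin x.

Lemma cisD (R : realType) (x y : R) : cis (x + y) = cis x * cis y.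
Proof. by apply: complex_ext; rewrite ?creM ?cimM /= ?cosD ?sinD//; ring. Qed.

Lemma normc_cis (R : realType) (x : R) : Normc.normc (cis x) = 1.
Proof. by rewrite /= cos2Dsin2 sqrtr1. Qed.

Lemma cmeasurable_cis d (T : measurableType d) (R : realType) (D : set T) (f : T -> R) :
  measurable_fun D f -> cmeasurable D (fun x => cis (f x)).
Proof.
move=> mf; split => /=.
  exact: (measurableT_comp (continuous_measurable_fun (@continuous_cos R)) mf).
exact: (measurableT_comp (continuous_measurable_fun (@continuous_sin R)) mf).
Qed.

Lemma cpowE (R : realType) (x a b : R) : 0 < x ->
  cpow x (a +i* b) = (x `^ a)%:C * cis (b * ln x).
Proof.
move=> x0; rewrite /cpow /expC powRE_gt0//.
by apply: complex_ext; rewrite ?creM ?cimM /=; rewrite !(mulr0, mul0r, subr0, addr0, add0r).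
Qed.

(** The integral of w(y) y^(it) dy.  The power of y usual in a Mellin transform is
absorbed in w, so that a vertical line of any abscissa is the imaginary axis
for a suitable weight. *)
Definition mellin (R : realType) (w : R -> R) (t : R) : R[i] :=
  integralC (pos R) (fun y => (w y)%:C * cis (t * ln y)).

(** On the line Re s = p the factor y^(p-1) e^(-y) is the weight, and y^(it) the
character. *)
Lemma GammaC_mellin (R : realType) (p t : R) :
  GammaC (p +i* t) = mellin (pow_exp p 1) t.
Proof.
apply: eq_integralC => y; rewrite set_itv0y => y0.
have -> : p +i* t - 1 = (p - 1) +i* t by apply: complex_ext; rewrite /= ?subr0.
rewrite cpowE// /pow_exp mul1r.
by apply: complex_ext; rewrite ?(creM, cimM) /=; ring.
Qed.

Lemma integrable_mellin (R : realType) (w : R -> R) (t : R) :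
  integrableR (pos R) w ->
  integrableC (pos R) (fun y => (w y)%:C * cis (t * ln y)).
Proof.
move=> iw; apply: (le_integrableC _ _ _ (integrable_norm iw)) => //.
  apply: cmeasurableM.
    by apply: cmeasurable_real; exact: measurable_integrableR iw.
  apply: cmeasurable_cis; apply: measurable_funM => //.
  by apply: measurable_funTS; exact: measurable_ln.
by move=> y _; rewrite Normc.normcM normc_cis normc_real mulr1.
Qed.

(** The factor 2 comes from bounding real and imaginary parts separately. *)
Lemma normc_mellin_le (R : realType) (w : R -> R) (t : R) :
  integrableR (pos R) w ->
  Normc.normc (mellin w t) <= 2 * Rintegral (leb R) (pos R) (fun y => `|w y|).
Proof.
move=> iw; have [i1 i2] := integrable_mellin t iw.
have iw' := integrable_norm iw.
apply: (le_trans (normc_le_absD _)); rewrite mulrDl mul1r lerD//=.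
  apply: (le_trans (le_normr_Rintegral _ i1)) => //.
  apply: le_Rintegral => //; first exact: integrable_norm.
  move=> y _; apply: (le_trans (normc_ge_absRe _)).
  by rewrite Normc.normcM normc_cis normc_real mulr1.
apply: (le_trans (le_normr_Rintegral _ i2)) => //.
apply: le_Rintegral => //; first exact: integrable_norm.
move=> y _; apply: (le_trans (normc_ge_absIm _)).
by rewrite Normc.normcM normc_cis normc_real mulr1.
Qed.

Lemma continuous_Rintegral_parameter (R : realType) (f : R -> R -> R) (g : R -> R) :
  (forall t, measurable_fun (pos R) (f t)) ->
  (forall y, 0 < y -> continuous (f ^~ y)) ->
  integrableR (pos R) g ->
  (forall t y, 0 < y -> `|f t y| <= g y) ->
  continuous (fun t => Rintegral (leb R) (pos R) (f t)).
Proof.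
move=> mf cf ig fg t.
have It : t \in (`](t - 1), (t + 1)[%classic : set R).
  by rewrite inE/= in_itv/= ltrBlDr ltrDl ltr01.
apply: (@continuity_under_integral R _ _ (leb R) f (pos R) _ (t - 1) (t + 1) _ _ g) => //.
- move=> s _; apply: (le_integrableR _ _ _ ig) => // y; rewrite set_itv0y; exact: fg.
- by apply: aeW => y; rewrite set_itv0y => y0 s _; exact: cf.
- by move=> s _; apply: aeW => y; rewrite set_itv0y; exact: fg.
Qed.

Lemma Rintegral_phase_continuous (R : realType) (w c : R -> R) :
  integrableR (pos R) w -> continuous c -> (forall x, `|c x| <= 1) ->
  continuous (fun t : R => Rintegral (leb R) (pos R) (fun y => w y * c (t * ln y))).
Proof.
move=> iw cc c1; have mw := measurable_integrableR iw.
apply: (@continuous_Rintegral_parameter R (fun t y => w y * c (t * ln y)) (fun y => `|w y|)).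
- move=> t; apply: measurable_funM => //; apply: measurable_funTS.
  apply: measurableT_comp; first exact: continuous_measurable_fun.
  by apply: measurable_funM => //; exact: measurable_ln.
- move=> y y0 t; apply: cvgM; first exact: cvg_cst.
  apply: (@continuous_comp R R R (fun t : R => t * ln y) c); last exact: cc.
  by apply: cvgM; [exact: cvg_id|exact: cvg_cst].
- exact: integrable_norm.
- by move=> t y _; rewrite normrM ler_piMr.
Qed.

Lemma Re_mellin (R : realType) (w : R -> R) (t : R) :
  complex.Re (mellin w t) =
  Rintegral (leb R) (pos R) (fun y => w y * cos (t * ln y)).
Proof. by apply: eq_Rintegral => y _; rewrite creM/= mul0r subr0. Qed.

Lemma Im_mellin (R : realType) (w : R -> R) (t : R) :
  complex.Im (mellin w t) =
  Rintegral (leb R) (pos R) (fun y => w y * sin (t * ln y)).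
Proof. by apply: eq_Rintegral => y _; rewrite cimM/= mul0r addr0. Qed.

Lemma cmeasurable_mellin (R : realType) (w : R -> R) :
  integrableR (pos R) w -> cmeasurable setT (mellin w).
Proof.
move=> iw; split; apply: continuous_measurable_fun.
  under eq_fun do rewrite Re_mellin.
  by apply: Rintegral_phase_continuous; [|exact: continuous_cos|exact: cos_max].
under eq_fun do rewrite Im_mellin.
by apply: Rintegral_phase_continuous; [|exact: continuous_sin|exact: sin_max].
Qed.

Lemma pow_expSE (R : realType) (p c y : R) : 0 < y ->
  pow_exp (p + 1) c y = y * pow_exp p c y.
Proof.
move=> y0; rewrite /pow_exp addrK mulrA; congr (_ * _).
rewrite powRB ?powRr1 ?(ltW y0)// ?(gt_eqF y0) ?implybT//.
by field; rewrite gt_eqF.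
Qed.

Lemma cvg0_squeeze (R : realType) (T : Type) (F : set_system T) (f g : T -> R) :
  Filter F -> (\forall x \near F, `|f x| <= g x) ->
  g x @[x --> F] --> 0 -> f x @[x --> F] --> 0.
Proof.
move=> FF fg g0; apply/norm_cvg0P; apply: (squeeze_cvgr _ (cvg_cst 0) g0).
by apply: filterS fg => x ->; rewrite normr_ge0.
Qed.

(** The derivative of y^p e^(-y) (a cos (t ln y) + b sin (t ln y)) has integral 0,
since this function vanishes at both ends.  Here wc and ws are the real and
imaginary parts of Gamma on a vertical line, so that a and b free encode the
complex identity Gamma (s + 1) = s Gamma s in real terms. *)
Lemma Gamma_by_parts (R : realType) (p t a b : R) : 0 < p ->
  let wc q := Rintegral (leb R) (pos R) (fun y => pow_exp q 1 y * cos (t * ln y)) in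
  let ws q := Rintegral (leb R) (pos R) (fun y => pow_exp q 1 y * sin (t * ln y)) in
  (p * a + t * b) * wc p + (p * b - t * a) * ws p - (a * wc (p + 1) + b * ws (p + 1)) = 0.
Proof.
move=> p0 wc ws.
pose ph (a b y : R) := a * cos (t * ln y) + b * sin (t * ln y).
pose F (y : R) := y `^ p * expR (- y) * ph a b y.
pose f (y : R) := (p * a + t * b) * (pow_exp p 1 y * cos (t * ln y)) +
  (p * b - t * a) * (pow_exp p 1 y * sin (t * ln y)) -
  (a * (pow_exp (p + 1) 1 y * cos (t * ln y)) + b * (pow_exp (p + 1) 1 y * sin (t * ln y))).
have ic q : 0 < q -> integrableR (pos R) (fun y => pow_exp q 1 y * cos (t * ln y)).
  move=> q0; have [ic _] := integrable_mellin t (integrable_pow_exp q0 ltr01).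
  by apply: eq_integrableR ic => // y _; rewrite creM/= mul0r subr0.
have is_ q : 0 < q -> integrableR (pos R) (fun y => pow_exp q 1 y * sin (t * ln y)).
  move=> q0; have [_ ic'] := integrable_mellin t (integrable_pow_exp q0 ltr01).
  by apply: eq_integrableR ic' => // y _; rewrite cimM/= mul0r addr0.
have p1 : 0 < p + 1 by rewrite addr_gt0.
have ic1 := ic _ p0; have ic2 := ic _ p1; have is1 := is_ _ p0; have is2 := is_ _ p1.
have iA := integrableRD (measurable_itv _) (integrableRZ (p * a + t * b) (measurable_itv _) ic1)
  (integrableRZ (p * b - t * a) (measurable_itv _) is1).
have iB := integrableRD (measurable_itv _) (integrableRZ a (measurable_itv _) ic2)
  (integrableRZ b (measurable_itv _) is2).
have intf : integrableR (pos R) f by exact: integrableRB.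
have <- : Rintegral (leb R) (pos R) f = (p * a + t * b) * wc p + (p * b - t * a) * ws p - (a * wc (p + 1) + b * ws (p + 1)).
  rewrite RintegralB// !RintegralD//; try exact: integrableRZ.
  by rewrite !RintegralZl.
have phb y : `|ph a b y| <= `|a| + `|b|.
  rewrite (le_trans (ler_normD _ _))// !normrM lerD// ler_piMr// ?cos_max ?sin_max//.
have dF (y : R) : 0 < y -> is_derive y 1 F (f y).
  move=> y0; have ? := is_derive1_ln y0; have ? := is_derive1_powR p y0.
  rewrite /F /ph; apply: is_derive_eq.
  rewrite /f pow_expSE// /pow_exp /GRing.scale/= !mul1r.
  have -> : y `^ p = y * y `^ (p - 1) by rewrite mulr_powRB1// ltW.
  by field; rewrite gt_eqF.
have FM y : 0 < y -> `|F y| <= (`|a| + `|b|) * (y `^ p * expR (- y)).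
  move=> y0; rewrite normrM ger0_norm ?mulr_ge0 ?powR_ge0 ?expR_ge0// mulrC.
  by rewrite ler_wpM2r ?mulr_ge0 ?powR_ge0 ?expR_ge0.
rewrite (@Rintegral_FTC0y R f F 0 0) ?subr0//.
- move=> y y0; rewrite /f.
  have cp q : {for y, continuous (pow_exp q 1)} by exact: continuous_pow_exp.
  have tl : {for y, continuous (fun y : R => t * ln y)}.
    by apply: cvgM; [exact: cvg_cst|exact: continuous_ln].
  have cc : {for y, continuous (fun y : R => cos (t * ln y))}.
    by apply: (continuous_comp tl); exact: continuous_cos.
  have cs : {for y, continuous (fun y : R => sin (t * ln y))}.
    by apply: (continuous_comp tl); exact: continuous_sin.
  by apply: cvgB; apply: cvgD; (apply: cvgM; [exact: cvg_cst|apply: cvgM; [exact: cp|first [exact: cc|exact: cs]]]).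
- apply: cvg0_squeeze (_ : (`|a| + `|b|) * y `^ p @[y --> 0^'+] --> 0).
    near=> y; have y0 : 0 < y by near: y; exact: nbhs_right_gt.
    apply: (le_trans (FM _ y0)); rewrite ler_wpM2l ?addr_ge0//.
    by rewrite ler_piMr ?powR_ge0// expR_le1 oppr_le0 ltW.
  rewrite -[X in _ --> X](mulr0 (`|a| + `|b|)); apply: cvgM; first exact: cvg_cst.
  exact: powR_cvg0.
- have [K K0 HK] := @powR_expR_bounded R (p + 1) 1 p1 ltr01.
  apply: cvg0_squeeze (_ : (`|a| + `|b|) * (K * y^-1) @[y --> +oo] --> 0).
    have : \forall y \near +oo, (0 : R) < y by exact: nbhs_pinfty_gt.
    apply: filterS => y y0; apply: (le_trans (FM _ y0)); rewrite ler_wpM2l ?addr_ge0//.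
    rewrite ler_pdivlMr//; have := HK y y0; rewrite mul1r; apply: le_trans.
    rewrite powRD ?powRr1 ?(ltW y0) ?(gt_eqF y0) ?implybT//.
    by rewrite mulrAC.
  rewrite -[X in _ --> X](mulr0 (`|a| + `|b|)); apply: cvgM; first exact: cvg_cst.
  rewrite -[X in _ --> X](mulr0 K); apply: cvgM; first exact: cvg_cst.
  by apply/gtr0_cvgV0; [exact: nbhs_pinfty_gt|exact: cvg_id].
Unshelve. all: end_near. Qed.

(** * Folding the line onto the half-line *)

Lemma ge0_integral_fold (R : realType) (f : R -> R) :
  continuous f -> (forall x, 0 <= f x) ->
  (\int[leb R]_x (f x)%:E =
   \int[leb R]_(x in pos R) (f x)%:E + \int[leb R]_(x in pos R) (f (- x))%:E)%E.
Proof.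
move=> cf f0.
have mf := continuous_measurable_fun cf.
have cfN : continuous (fun x => f (- x)).
  by move=> x; apply: continuous_comp; [exact: continuousN|exact: cf].
rewrite -(setUv (pos R)) ge0_integral_setU//=; last 4 first.
- exact: measurableC.
- by apply/measurable_EFinP; rewrite setUv.
- by move=> x _; rewrite lee_fin.
- exact/disj_setPCl.
congr (_ + _)%E.
rewrite setCitvr.
have := @ge0_integration_by_substitutionNy R f 0.
rewrite oppr0 => ->.
- rewrite -integral_itv_obnd_cbnd//.
  apply/measurable_EFinP/measurable_funTS; exact: continuous_measurable_fun.
- exact: continuous_subspaceT.
- by move=> x _; exact: f0.
Qed.

Lemma integrableR_fold (R : realType) (f : R -> R) : continuous f ->
  integrableR setT f <-> integrableR (pos R) f /\ integrableR (pos R) (fun x => f (- x)).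
Proof.
move=> cf; have cfN : continuous (fun x => f (- x)).
  by move=> x; apply: continuous_comp; [exact: continuousN|exact: cf].
have cn : continuous (fun x => `|f x|).
  by move=> x; apply: continuous_comp; [exact: cf|exact: norm_continuous].
have mf := continuous_measurable_fun cf; have mfN := continuous_measurable_fun cfN.
have := ge0_integral_fold cn (fun x => normr_ge0 _) => E.
split=> [/integrableP[_ fy]|[/integrableP[_ f1] /integrableP[_ f2]]].
  have : (\int[leb R]_x (`|f x|)%:E < +oo)%E by exact: fy.
  rewrite E => fy'; split; apply/integrableP; split;
    try by apply/measurable_EFinP/measurable_funTS.
  - by apply: le_lt_trans fy'; rewrite leeDl// integral_ge0.
  - by apply: le_lt_trans fy'; rewrite leeDr// integral_ge0.
apply/integrableP; split; first exact/measurable_EFinP.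
by apply: (@le_lt_trans _ _ (\int[leb R]_x (`|f x|)%:E)%E) => //; rewrite E lte_add_pinfty.
Qed.

(** The nonnegative case is applied to |f| and to |f| + f, and subtracted. *)
Lemma Rintegral_fold (R : realType) (f : R -> R) : continuous f -> integrableR setT f ->
  Rintegral (leb R) setT f = Rintegral (leb R) (pos R) (fun x => f x + f (- x)).
Proof.
move=> cf fi; have [f1 f2] := (integrableR_fold cf).1 fi.
have cn : continuous (fun x => `|f x|).
  by move=> x; apply: continuous_comp; [exact: cf|exact: norm_continuous].
have ni := integrable_norm fi.
have [n1 n2] := (integrableR_fold cn).1 ni.
have ge0_case (g : R -> R) : continuous g -> (forall x, 0 <= g x) -> integrableR setT g ->
    Rintegral (leb R) setT g = Rintegral (leb R) (pos R) g + Rintegral (leb R) (pos R) (fun x => g (- x)).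
  move=> cg g0 gi; have [g1 g2] := (integrableR_fold cg).1 gi.
  apply: EFin_inj; rewrite EFinD -!RintegralE_EFin//.
  exact: ge0_integral_fold.
rewrite RintegralD//.
have H1 := ge0_case _ cn (fun x => normr_ge0 _) ni.
have cs : continuous (fun x => `|f x| + f x).
  by move=> x; apply: cvgD; [exact: cn|exact: cf].
have H2 := ge0_case (fun x => `|f x| + f x) cs.
move: H2; rewrite RintegralD// [in X in _ -> _ -> _ = X + _]RintegralD// [in X in _ -> _ -> _ = _ + X]RintegralD// => H2.
suff : Rintegral (leb R) setT (fun x : R => `|f x|) + Rintegral (leb R) setT f =
  Rintegral (leb R) (pos R) (fun x => `|f x|) + Rintegral (leb R) (pos R) f +
  (Rintegral (leb R) (pos R) (fun x => `|f (- x)|) + Rintegral (leb R) (pos R) (fun x => f (- x))).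
  rewrite H1; lra.
apply: H2; first by move=> x; have := ler_norm (- f x); rewrite normrN; lra.
exact: integrableRD.
Qed.

(** * Functional equation and decay of Gamma *)

(** The real and the imaginary part are the cases (a, b) = (1, 0) and (0, 1) of
[Gamma_by_parts]. *)
Lemma mellin_pow_expS (R : realType) (p t : R) : 0 < p ->
  mellin (pow_exp (p + 1) 1) t = (p +i* t) * mellin (pow_exp p 1) t.
Proof.
move=> p0.
have /= := @Gamma_by_parts R p t 1 0 p0; have /= := @Gamma_by_parts R p t 0 1 p0.
move: (pow_exp (p + 1) 1) (pow_exp p 1) => w1 w2 Hs Hc.
apply: complex_ext.
  rewrite creM !Re_mellin Im_mellin (_ : complex.Re (p +i* t) = p)//.
  rewrite (_ : complex.Im (p +i* t) = t)//.
  by move: (Rintegral _ _ _) (Rintegral _ _ _) (Rintegral _ _ _) (Rintegral _ _ _) Hc Hs => a b c d; lra.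
rewrite cimM !Im_mellin Re_mellin (_ : complex.Re (p +i* t) = p)//.
rewrite (_ : complex.Im (p +i* t) = t)//.
by move: (Rintegral _ _ _) (Rintegral _ _ _) (Rintegral _ _ _) (Rintegral _ _ _) Hc Hs => a b c d; lra.
Qed.

Lemma GammaC_add1 (R : realType) (s : R[i]) : 0 < complex.Re s ->
  GammaC (s + 1) = s * GammaC s.
Proof.
case: s => p t /= p0.
have -> : p +i* t + 1 = (p + 1) +i* t by apply: complex_ext; rewrite /= ?addr0.
by rewrite !GammaC_mellin mellin_pow_expS.
Qed.

Lemma mellin_at0 (R : realType) (w : R -> R) :
  mellin w 0 = (Rintegral (leb R) (pos R) w)%:C.
Proof.
apply: complex_ext; rewrite ?Re_mellin ?Im_mellin/=.
  by apply: eq_Rintegral => y _; rewrite mul0r cos0 mulr1.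
under eq_Rintegral do rewrite mul0r sin0 mulr0.
by rewrite Rintegral_cst ?mul0r.
Qed.

Lemma GammaR_add1 (R : realType) (p : R) : 0 < p -> GammaR (p + 1) = p * GammaR p.
Proof.
move=> p0; have := mellin_pow_expS 0 p0.
move=> /(congr1 (@complex.Re R)); rewrite !mellin_at0 creM -!GammaR_pow_exp/= => ->.
ring.
Qed.

Lemma GammaR1 (R : realType) : GammaR (1 : R) = 1.
Proof.
rewrite GammaR_pow_exp.
transitivity (0 - (- 1) : R); last by rewrite sub0r opprK.
apply: (@Rintegral_FTC0y R _ (fun y => - expR (- y)) (- 1) 0).
- by move=> y; exact: continuous_pow_exp.
- move=> y y0; apply: is_derive_eq.
  by rewrite /pow_exp subrr powRr0 /GRing.scale/= !mul1r mulrN1 opprK.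
- exact: (integrable_pow_exp ltr01 ltr01).
- rewrite -expR0 -[X in expR X]oppr0; apply: cvg_at_right_filter.
  apply: cvgN; apply: continuous_comp; [exact: continuousN|exact: continuous_expR].
- by rewrite -[X in _ --> X]oppr0; apply: cvgN; exact: cvgr_expR.
Qed.

Lemma GammaR_fact (R : realType) (n : nat) : GammaR (n%:R + 1 : R) = n`!%:R.
Proof.
elim: n => [|n IH]; first by rewrite add0r GammaR1.
by rewrite GammaR_add1 ?ltr_wpDr// -natr1 IH factS natrM natr1.
Qed.

(** The arctangent is a bounded primitive. *)
Lemma integrable_inv_addsqr (R : realType) (p : R) : 0 < p ->
  integrableR (setT : set R) (fun t : R => (p ^+ 2 + t ^+ 2)^-1).
Proof.
move=> p0.
have D0 (t : R) : 0 < p ^+ 2 + t ^+ 2 by rewrite ltr_pwDl ?sqr_ge0 ?exprn_gt0.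
have cf : continuous (fun t : R => (p ^+ 2 + t ^+ 2)^-1).
  move=> t; apply: cvgV; first by rewrite gt_eqF.
  by apply: cvgD; [exact: cvg_cst|exact: exprn_continuous].
have i1 : integrableR (pos R) (fun t : R => (p ^+ 2 + t ^+ 2)^-1).
  apply: (@integrable0y_bounded_primitive R _ (fun t : R => p^-1 * atan (p^-1 * t)) (p^-1 * (pi / 2))).
  - by move=> t _; rewrite invr_ge0 ltW.
  - by move=> t _; exact: cf.
  - move=> t _; apply: is_derive_eq.
    rewrite /GRing.scale/= !mulr1; field.
    by rewrite gt_eqF ?D0//= gt_eqF.
  - move=> t _; rewrite normrM ger0_norm ?invr_ge0 ?(ltW p0)// ler_pM2l ?invr_gt0//.
    by rewrite ler_norml (ltW (atan_gtNpi2 _)) (ltW (atan_ltpi2 _)).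
apply/integrableR_fold => //; split=> //.
by under [X in _.-integrable _ (EFin \o X)]eq_fun do rewrite sqrrN.
Qed.

(** Two steps of the functional equation: Gamma (s + 2) = (s + 1) s Gamma s, the
left side is bounded on the line, and |s + 1| |s| >= |s|^2 = p^2 + t^2. *)
Lemma normc_Gamma_le (R : realType) (p t : R) : 0 < p ->
  Normc.normc (mellin (pow_exp p 1) t) <= 2 * GammaR (p + 2) * (p ^+ 2 + t ^+ 2)^-1.
Proof.
move=> p0; have p1 : 0 < p + 1 by rewrite addr_gt0.
have := normc_mellin_le t (@integrable_pow_exp R (p + 2) 1 _ ltr01).
rewrite (_ : p + 2 = p + 1 + 1); last by ring.
rewrite (mellin_pow_expS t p1) (mellin_pow_expS t p0) !Normc.normcM.
rewrite (_ : Rintegral _ _ _ = GammaR (p + 1 + 1)); last first.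
  rewrite GammaR_pow_exp; apply: eq_Rintegral => y _.
  by rewrite ger0_norm// pow_exp_ge0.
rewrite ler_pdivlMr; last by rewrite ltr_pwDl ?sqr_ge0 ?exprn_gt0.
move=> /(_ (addr_gt0 p1 ltr01)); apply: le_trans.
rewrite mulrA [leLHS]mulrC ler_wpM2r ?normc_ge0//=.
have S0 : 0 <= p ^+ 2 + t ^+ 2 by rewrite addr_ge0 ?sqr_ge0.
have S1 : 0 <= (p + 1) ^+ 2 + t ^+ 2 by rewrite addr_ge0 ?sqr_ge0.
rewrite -[leLHS](sqr_sqrtr S0) expr2 ler_wpM2r ?sqrtr_ge0// ler_sqrt// lerD2r.
by rewrite ler_sqr ?nnegrE ?(ltW p0) ?(ltW p1)// lerDl.
Qed.

Lemma integrable_mellin_pow_exp (R : realType) (p : R) : 0 < p ->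
  integrableC setT (mellin (pow_exp p 1)).
Proof.
move=> p0; apply: (le_integrableC _ _ _ (@integrableRZ R setT (2 * GammaR (p + 2)) _ measurableT (integrable_inv_addsqr p0))) => //.
  by apply: cmeasurable_mellin; exact: integrable_pow_exp.
by move=> t _; exact: normc_Gamma_le.
Qed.

(** * Damped trigonometric integrals *)

Lemma integrable_expRN (R : realType) (c : R) : 0 < c ->
  integrableR (pos R) (fun t => expR (- (c * t))).
Proof.
move=> c0; apply: (eq_integrableR _ _ (@integrable_pow_exp R 1 c ltr01 c0)) => //.
by move=> t _; rewrite /pow_exp subrr powRr0 mul1r.
Qed.

Lemma continuous_expRN (R : realType) (c : R) : continuous (fun t : R => expR (- (c * t))).
Proof.
move=> t; apply: (@continuous_comp R R R (fun t : R => - (c * t)) expR).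
  by apply: cvgN; apply: cvgM; [exact: cvg_cst|exact: cvg_id].
exact: continuous_expR.
Qed.

Lemma expRN_cvgy (R : realType) (c : R) : 0 < c -> expR (- (c * t)) @[t --> +oo] --> 0.
Proof.
move=> c0; apply: (@cvg_comp _ _ _ (fun t => c * t) (fun z => expR (- z)) _ +oo).
  by apply: gt0_cvgMry => //; exact: cvg_id.
exact: cvgr_expR.
Qed.

Lemma measurable_continuous_comp (R : realType) (D : set R) (c f : R -> R) :
  continuous c -> measurable_fun D f -> measurable_fun D (c \o f).
Proof. by move=> cc mf; exact: (measurableT_comp (continuous_measurable_fun cc) mf). Qed.

Lemma integrable_damped (R : realType) (c v : R) (ph : R -> R) : 0 < c ->
  continuous ph -> (forall z, `|ph z| <= 1) ->
  integrableR (pos R) (fun t => expR (- (c * t)) * ph (t * v)).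
Proof.
move=> c0 cp p1.
apply: (le_integrableR _ _ _ (integrable_expRN c0)) => //.
  apply: measurable_funM; first by apply: measurable_funTS; apply: continuous_measurable_fun; exact: continuous_expRN.
  apply: (@measurable_continuous_comp _ _ ph (fun t => t * v)) => //.
  exact: measurable_funM.
by move=> t _; rewrite normrM ger0_norm ?expR_ge0//; apply: ler_piMr; rewrite ?expR_ge0 ?p1.
Qed.

Lemma continuous_phase (R : realType) (v : R) (ph : R -> R) :
  continuous ph -> continuous (fun t : R => ph (t * v)).
Proof.
move=> cp t; apply: (@continuous_comp R R R (fun t : R => t * v) ph); last exact: cp.
by apply: cvgM; [exact: cvg_id|exact: cvg_cst].
Qed.

(** The integrand is the derivative of e^(-ct) (p cos tv + q sin tv), which is p at
0 and vanishes at infinity.  The cosine and the sine integral are two choices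
of (p, q). *)
Lemma damped_FTC (R : realType) (c v p q : R) : 0 < c ->
  Rintegral (leb R) (pos R) (fun t => expR (- (c * t)) *
    ((- c * p + v * q) * cos (t * v) + (- c * q - v * p) * sin (t * v))) = - p.
Proof.
move=> c0.
have cc : continuous (fun t : R => cos (t * v)) by apply: continuous_phase; exact: continuous_cos.
have cs : continuous (fun t : R => sin (t * v)) by apply: continuous_phase; exact: continuous_sin.
transitivity (0 - p); last by rewrite sub0r.
apply: (@Rintegral_FTC0y R _ (fun t : R => expR (- (c * t)) * (p * cos (t * v) + q * sin (t * v)))).
- move=> t _; apply: cvgM; first exact: continuous_expRN.
  by apply: cvgD; (apply: cvgM; [exact: cvg_cst|]); [exact: cc|exact: cs].
- by move=> t _; apply: is_derive_eq; rewrite /GRing.scale/=; ring.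
- have ic := @integrable_damped R c v _ c0 (@continuous_cos R) (@cos_max R).
  have is_ := @integrable_damped R c v _ c0 (@continuous_sin R) (@sin_max R).
  have := integrableRD (measurable_itv _) (integrableRZ (- c * p + v * q) (measurable_itv _) ic)
    (integrableRZ (- c * q - v * p) (measurable_itv _) is_).
  by apply: eq_integrableR => // t _; ring.
- have E : expR (- (c * 0)) * (p * cos (0 * v) + q * sin (0 * v)) = p.
    by rewrite mulr0 oppr0 expR0 mul0r cos0 sin0; ring.
  rewrite -[X in _ --> X]E.
  apply: cvg_at_right_filter; apply: cvgM; first exact: continuous_expRN.
  by apply: cvgD; (apply: cvgM; [exact: cvg_cst|]); [exact: cc|exact: cs].
- apply: (@cvg0_squeeze _ _ _ _ (fun t => expR (- (c * t)) * (`|p| + `|q|))).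
    apply: nearW => t; rewrite normrM ger0_norm ?expR_ge0// ler_wpM2l ?expR_ge0//.
    rewrite (le_trans (ler_normD _ _))// !normrM lerD// ler_piMr// ?cos_max ?sin_max//.
  rewrite -[X in _ --> X](mul0r (`|p| + `|q|)); apply: cvgM; last exact: cvg_cst.
  exact: expRN_cvgy.
Qed.

Lemma Rintegral_expN_cos (R : realType) (c v : R) : 0 < c ->
  Rintegral (leb R) (pos R) (fun t => expR (- (c * t)) * cos (t * v)) = c / (c ^+ 2 + v ^+ 2).
Proof.
move=> c0; have D0 : c ^+ 2 + v ^+ 2 != 0 by rewrite gt_eqF// ltr_pwDl ?sqr_ge0// exprn_gt0.
have := @damped_FTC R c v (- (c / (c ^+ 2 + v ^+ 2))) (v / (c ^+ 2 + v ^+ 2)) c0.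
rewrite opprK => <-; apply: eq_Rintegral => t _; field.
by [].
Qed.

Lemma Rintegral_expN_sin (R : realType) (c v : R) : 0 < c ->
  Rintegral (leb R) (pos R) (fun t => expR (- (c * t)) * sin (t * v)) = v / (c ^+ 2 + v ^+ 2).
Proof.
move=> c0; have D0 : c ^+ 2 + v ^+ 2 != 0 by rewrite gt_eqF// ltr_pwDl ?sqr_ge0// exprn_gt0.
have := @damped_FTC R c v (- (v / (c ^+ 2 + v ^+ 2))) (- (c / (c ^+ 2 + v ^+ 2))) c0.
rewrite opprK => <-; apply: eq_Rintegral => t _; field.
by [].
Qed.

Lemma continuous_expRN_abs (R : realType) (c : R) : continuous (fun t : R => expR (- (c * `|t|))).
Proof.
move=> t; apply: (@continuous_comp R R R (fun t => `|t|) (fun z => expR (- (c * z)))).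
  exact: norm_continuous.
exact: continuous_expRN.
Qed.

Lemma integrable_expRN_abs (R : realType) (c : R) : 0 < c ->
  integrableR setT (fun t : R => expR (- (c * `|t|))).
Proof.
move=> c0; apply/integrableR_fold; first exact: continuous_expRN_abs.
by split; apply: (eq_integrableR _ _ (integrable_expRN c0)) => // t;
  rewrite set_itv0y => t0; rewrite ?normrN gtr0_norm.
Qed.

Lemma integrableC_expRN_abs_cis (R : realType) (c v : R) : 0 < c ->
  integrableC setT (fun t : R => (expR (- (c * `|t|)))%:C * cis (t * v)).
Proof.
move=> c0; apply: (le_integrableC _ _ _ (integrable_expRN_abs c0)) => //.
  apply: cmeasurableM.
    apply: cmeasurable_real; apply: continuous_measurable_fun; exact: continuous_expRN_abs.
  by apply: cmeasurable_cis; exact: measurable_funM.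
by move=> t _; rewrite Normc.normcM normc_cis normc_real mulr1 ger0_norm ?expR_ge0.
Qed.

(** The Fourier transform of e^(-c|t|), a Poisson kernel: folded onto the
half-line, the cosines double and the sines cancel. *)
Lemma integralC_expRN_abs_cis (R : realType) (c v : R) : 0 < c ->
  integralC setT (fun t : R => (expR (- (c * `|t|)))%:C * cis (t * v)) =
  (2 * c / (c ^+ 2 + v ^+ 2))%:C.
Proof.
move=> c0; have [i1 i2] := integrableC_expRN_abs_cis v c0.
have ca := @continuous_expRN_abs R c.
have cc : continuous (fun t : R => cos (t * v)) by apply: continuous_phase; exact: continuous_cos.
have cs : continuous (fun t : R => sin (t * v)) by apply: continuous_phase; exact: continuous_sin.
have RE t : complex.Re ((expR (- (c * `|t|)))%:C * cis (t * v)) = expR (- (c * `|t|)) * cos (t * v).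
  by rewrite creM/= mul0r subr0.
have IE t : complex.Im ((expR (- (c * `|t|)))%:C * cis (t * v)) = expR (- (c * `|t|)) * sin (t * v).
  by rewrite cimM/= mul0r addr0.
apply: complex_ext.
  transitivity (Rintegral (leb R) setT (fun t => expR (- (c * `|t|)) * cos (t * v))).
    by apply: eq_Rintegral => t _; exact: RE.
  rewrite Rintegral_fold; last 2 first.
  - by move=> t; apply: cvgM; [exact: ca|exact: cc].
  - by apply: (eq_integrableR _ _ i1) => // t _; exact: RE.
  transitivity (Rintegral (leb R) (pos R) (fun t => 2 * (expR (- (c * t)) * cos (t * v)))).
    apply: eq_Rintegral => t; rewrite inE set_itv0y => t0.
    by rewrite normrN gtr0_norm// mulNr cosN; ring.
  rewrite RintegralZl//; first by rewrite Rintegral_expN_cos//= mulrA.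
  exact: (integrable_damped _ c0 (@continuous_cos R) (@cos_max R)).
transitivity (Rintegral (leb R) setT (fun t => expR (- (c * `|t|)) * sin (t * v))).
  by apply: eq_Rintegral => t _; exact: IE.
rewrite Rintegral_fold; last 2 first.
- by move=> t; apply: cvgM; [exact: ca|exact: cs].
- by apply: (eq_integrableR _ _ i2) => // t _; exact: IE.
transitivity (Rintegral (leb R) (pos R) (cst 0)); last by rewrite Rintegral_cst ?mul0r.
apply: eq_Rintegral => t _.
by rewrite normrN mulNr sinN/=; ring.
Qed.

Lemma Rintegral_inv_add1sqr (R : realType) :
  Rintegral (leb R) setT (fun t : R => (1 + t ^+ 2)^-1) = pi.
Proof.
have i1 : integrableR setT (fun t : R => (1 + t ^+ 2)^-1).
  apply: (eq_integrableR _ _ (@integrable_inv_addsqr R 1 ltr01)) => // t _.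
  by rewrite expr1n.
have D0 (t : R) : 1 + t ^+ 2 != 0 by rewrite gt_eqF// ltr_pwDl ?sqr_ge0.
have cf : continuous (fun t : R => (1 + t ^+ 2)^-1).
  move=> t; apply: cvgV => //.
  by apply: cvgD; [exact: cvg_cst|exact: exprn_continuous].
have [i2 i3] := (integrableR_fold cf).1 i1.
rewrite Rintegral_fold// RintegralD//.
under [X in _ + X]eq_Rintegral do rewrite sqrrN.
rewrite (_ : Rintegral _ _ _ = pi / 2 - 0); first by rewrite subr0; lra.
apply: (@Rintegral_FTC0y R _ (@atan R)) => //.
- by move=> t _; exact: cf.
- rewrite -[X in _ --> X]atan0; apply: cvg_at_right_filter; exact: continuous_atan.
- exact: cvgy_atan.
Qed.

(** * Mellin inversion *)

Lemma creZ (R : realType) (r : R) (z : R[i]) : complex.Re (r%:C * z) = r * complex.Re z.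
Proof. by rewrite creM/= mul0r subr0. Qed.

Lemma cimZ (R : realType) (r : R) (z : R[i]) : complex.Im (r%:C * z) = r * complex.Im z.
Proof. by rewrite cimM/= mul0r addr0. Qed.

Lemma integralC_real (R : realType) (D : set R) (r : R -> R) : measurable D ->
  integralC D (fun x => (r x)%:C) = (Rintegral (leb R) D r)%:C.
Proof.
by move=> mD; apply: complex_ext; rewrite //= Rintegral_cst ?mul0r.
Qed.

Lemma normc_integrable (R : realType) (D : set R) (f : R -> R[i]) : measurable D ->
  integrableC D f ->
  integrableR D (fun x => `|complex.Re (f x)| + `|complex.Im (f x)|).
Proof.
by move=> mD [f1 f2]; apply: integrableRD => //; exact: integrable_norm.
Qed.

(** After the exchange of the integrals, which the damping factor allows, the
inner integral over t is a Poisson kernel in ln y - b. *)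
Lemma mellin_regularized (R : realType) (w : R -> R) (b e : R) :
  0 < e -> measurable_fun setT w -> (forall y, 0 <= w y) -> integrableR (pos R) w ->
  integralC setT (fun t : R =>
    (expR (- (e * `|t|)))%:C * (cis (- (t * b)) * mellin w t)) =
  (Rintegral (leb R) (pos R) (fun y => w y * (2 * e / (e ^+ 2 + (ln y - b) ^+ 2))))%:C.
Proof.
move=> e0 mw w0 iw.
pose f (t y : R) : R[i] :=
  (expR (- (e * `|t|)))%:C * cis (- (t * b)) * ((w y)%:C * cis (t * ln y)).
transitivity (integralC setT (fun t => integralC (pos R) (f t))).
  apply: eq_integralC => t _; rewrite /f integralCZ//; last exact: integrable_mellin.
  by rewrite mulrA.
rewrite (@integralC_Fubini R setT (pos R) f (fun t => expR (- (e * `|t|))) w)//.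
- rewrite -integralC_real//; apply: eq_integralC => y _.
  rewrite (_ : (f^~ y) = (fun t => (w y)%:C * ((expR (- (e * `|t|)))%:C * cis (t * (ln y - b))))).
    rewrite integralCZ//; last exact: integrableC_expRN_abs_cis.
    by rewrite integralC_expRN_abs_cis// -rmorphM.
  apply/funext => t; rewrite /f mulrBr cisD; ring.
- apply: cmeasurableM; first apply: cmeasurableM.
  + apply: cmeasurable_real.
    apply: (measurableT_comp (f := fun t : R => expR (- (e * `|t|)))) => //.
    by apply: continuous_measurable_fun; exact: continuous_expRN_abs.
  + apply: cmeasurable_cis; apply: measurableT_comp => //.
    by apply: measurable_funM.
  + apply: cmeasurableM.
      by apply: cmeasurable_real; exact: measurableT_comp.
    apply: cmeasurable_cis; apply: measurable_funM => //.
    by apply: measurableT_comp => //; exact: measurable_ln.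
- exact: integrable_expRN_abs.
- move=> t y _ _; rewrite /f !Normc.normcM !normc_cis !normc_real.
  by rewrite !mulr1 (ger0_norm (expR_ge0 _)) (ger0_norm (w0 _)).
Qed.

(** With y = x exp (ev) the Poisson kernel, which concentrates at x as e tends to
0, becomes independent of e, and all the dependence on e moves to the argument
of w. *)
Lemma poisson_subst (R : realType) (w : R -> R) (x e : R) :
  0 < e -> 0 < x -> (forall y, 0 <= w y) -> (forall y : R, 0 < y -> {for y, continuous w}) ->
  Rintegral (leb R) (pos R) (fun y => w y * (2 * e / (e ^+ 2 + (ln y - ln x) ^+ 2))) =
  Rintegral (leb R) setT (fun v => w (x * expR (e * v)) * (x * expR (e * v)) * (2 * (1 + v ^+ 2)^-1)).
Proof.
move=> e0 x0 w0 cw.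
have D0 (t : R) : 1 + t ^+ 2 != 0 by rewrite gt_eqF// ltr_pwDl ?sqr_ge0.
pose G (v : R) := w (x * expR (e * v)) * (x * expR (e * v)) * (2 * (1 + v ^+ 2)^-1).
rewrite [RHS]/Rintegral (@ge0_integral_ln_subst R (ln x) e G)//.
- apply: eq_Rintegral => y; rewrite inE set_itv0y => y0.
  rewrite /G (_ : e * ((ln y - ln x) / e) = ln y - ln x); last by field; rewrite gt_eqF.
  rewrite expRB !lnK ?posrE// (_ : x * (y / x) = y); last by field; rewrite gt_eqF.
  move: (ln y - ln x) => d.
  have Hd : e ^+ 2 + d ^+ 2 != 0 by rewrite gt_eqF// ltr_pwDl ?sqr_ge0// exprn_gt0.
  by field; rewrite Hd !gt_eqF.
- have cx : continuous (fun v : R => x * expR (e * v)).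
    move=> v; apply: cvgM; first exact: cvg_cst.
    apply: (@continuous_comp R R R (fun v => e * v) expR); last exact: continuous_expR.
    by apply: cvgM; [exact: cvg_cst|exact: cvg_id].
  move=> v; apply: cvgM; first apply: cvgM.
  + apply: (@continuous_comp R R R (fun v : R => x * expR (e * v)) w); first exact: cx.
    by apply: cw; rewrite mulr_gt0// expR_gt0.
  + exact: cx.
  + apply: cvgM; first exact: cvg_cst.
    apply: cvgV => //.
    by apply: cvgD; [exact: cvg_cst|exact: exprn_continuous].
- move=> v; rewrite /G !mulr_ge0 ?expR_ge0 ?(ltW x0)// invr_ge0 addr_ge0 ?sqr_ge0//.
Qed.

Lemma cvg_harmonicM (R : realType) (v : R) : @harmonic R n * v @[n --> \oo] --> 0.
Proof. by rewrite -[X in _ --> X](mul0r v); apply: cvgM; [exact: cvg_harmonic|exact: cvg_cst]. Qed.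

(** As the damping e = 1/(n+1) tends to 0, the regularised integral A n tends to
the integral sought, dominated by the transform of w; on the other
hand, by [poisson_subst], it tends to w(x) x times the integral of
2/(1 + v^2), dominated thanks to the bound M on y w(y). *)
Theorem mellin_inversion (R : realType) (w : R -> R) (M x : R) :
  measurable_fun setT w -> (forall y, 0 <= w y) ->
  (forall y : R, 0 < y -> {for y, continuous w}) ->
  integrableR (pos R) w -> (forall y, 0 < y -> y * w y <= M) ->
  integrableC setT (mellin w) -> 0 < x ->
  integralC setT (fun t => cis (- (t * ln x)) * mellin w t) = (2 * pi * (x * w x))%:C.
Proof.
move=> mw w0 cw iw wM im x0.
(* The strength of the damping; any sequence tending to 0 from above would do. *)
pose e n : R := harmonic n.
have e0 n : 0 < e n by rewrite /e/= invr_gt0.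
pose A n := integralC setT (fun t : R =>
    (expR (- (e n * `|t|)))%:C * (cis (- (t * ln x)) * mellin w t)).
have A1 : cvgC A (integralC setT (fun t => cis (- (t * ln x)) * mellin w t)).
  apply: (dominated_cvgC _ _ _ (normc_integrable _ im) _).2 => //.
  - move=> n; apply: cmeasurableM.
      apply: cmeasurable_real; apply: continuous_measurable_fun; exact: continuous_expRN_abs.
    apply: cmeasurableM; last exact: cmeasurable_mellin.
    by apply: cmeasurable_cis; apply: measurableT_comp => //; exact: measurable_funM.
  - move=> t _.
    have E1 : expR (- (e n * `|t|)) @[n --> \oo] --> (1 : R).
      rewrite -[X in _ --> X]expR0 -[X in expR X]oppr0.
      apply: (@continuous_cvg _ _ _ _ _ (fun n => - (e n * `|t|)) expR).
        exact: continuous_expR.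
      by apply: cvgN; exact: cvg_harmonicM.
    have SZ (l : R) : expR (- (e n * `|t|)) * l @[n --> \oo] --> l.
      by rewrite -[X in _ --> X]mul1r; apply: cvgM => //; exact: cvg_cst.
    split.
      under eq_fun do rewrite creZ.
      exact: SZ.
    under eq_fun do rewrite cimZ.
    exact: SZ.
  - move=> n t _; rewrite !Normc.normcM normc_cis mul1r normc_real ger0_norm ?expR_ge0//.
    apply: le_trans (normc_le_absD _); rewrite ler_piMl ?normc_ge0//.
    by rewrite expR_le1 oppr_le0 mulr_ge0// ltW.
have A2 : cvgC A (2 * pi * (x * w x))%:C.
  have AE n : A n = (Rintegral (leb R) setT (fun v : R =>
      w (x * expR (e n * v)) * (x * expR (e n * v)) * (2 * (1 + v ^+ 2)^-1)))%:C.
    by rewrite /A mellin_regularized// poisson_subst.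
  have i1 : integrableR setT (fun t : R => (1 + t ^+ 2)^-1).
    apply: (eq_integrableR _ _ (@integrable_inv_addsqr R 1 ltr01)) => // t _.
    by rewrite expr1n.
  have H : Rintegral (leb R) setT (fun v : R =>
      w (x * expR (e n * v)) * (x * expR (e n * v)) * (2 * (1 + v ^+ 2)^-1)) @[n --> \oo] -->
      Rintegral (leb R) setT (fun v : R => w x * x * (2 * (1 + v ^+ 2)^-1)).
    apply: (Rdominated_cvg _ _ _ (integrableRZ (M * 2) _ i1) _).2 => //.
    - move=> n.
      have mx : measurable_fun setT (fun v : R => x * expR (e n * v)).
        apply: measurable_funM => //; apply: measurableT_comp; first exact: measurable_expR.
        exact: measurable_funM.
      apply: measurable_funM; first apply: measurable_funM => //.
        exact: measurableT_comp.
      by apply: measurable_funM => //; exact: measurable_integrableR i1.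
    - move=> v _; apply: cvgM; last exact: cvg_cst.
      have E1 : x * expR (e n * v) @[n --> \oo] --> x.
        rewrite -[X in _ --> X]mulr1 -expR0; apply: cvgM; first exact: cvg_cst.
        apply: (@continuous_cvg _ _ _ _ _ (fun n => e n * v) expR).
          exact: continuous_expR.
        exact: cvg_harmonicM.
      by apply: cvgM => //; apply: (@continuous_cvg _ _ _ _ _ (fun n => x * expR (e n * v)) w) => //; exact: cw.
    - move=> n v _.
      have y0 : 0 < x * expR (e n * v) by rewrite mulr_gt0// expR_gt0.
      have i0 : 0 <= (1 + v ^+ 2)^-1 by rewrite invr_ge0 addr_ge0 ?sqr_ge0.
      rewrite ger0_norm; last by rewrite !mulr_ge0// ltW.
      by rewrite [leLHS]mulrA ler_wpM2r// ler_wpM2r// mulrC wM.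
  have {}AE := funext AE; rewrite AE.
  split; last exact: cvg_cst.
  move: H; rewrite RintegralZl//; last by apply: integrableRZ.
  rewrite RintegralZl// Rintegral_inv_add1sqr.
  by rewrite (_ : w x * x * (2 * pi) = 2 * pi * (x * w x)); last ring.
exact: cvgC_unique A1 A2.
Qed.

(** * The Cahen-Mellin integral and the product formula *)

Lemma cmeasurable_cisM (R : realType) (v : R) (f : R -> R[i]) :
  cmeasurable setT f -> cmeasurable setT (fun t : R => cis (- (t * v)) * f t).
Proof.
move=> mf; apply: cmeasurableM => //; apply: cmeasurable_cis.
by apply: measurableT_comp => //; exact: measurable_funM.
Qed.

Lemma integrableC_cisM (R : realType) (v : R) (f : R -> R[i]) :
  integrableC setT f -> integrableC setT (fun t : R => cis (- (t * v)) * f t).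
Proof.
move=> fi; apply: (le_integrableC _ _ _ (normc_integrable _ fi)) => //.
  by apply: cmeasurable_cisM; exact: integrableC_measurable.
by move=> t _; rewrite Normc.normcM normc_cis mul1r normc_le_absD.
Qed.

Lemma mellin_inversion_pow_exp (R : realType) (p x : R) : 0 < p -> 0 < x ->
  integralC setT (fun t => cis (- (t * ln x)) * mellin (pow_exp p 1) t) =
  (2 * pi * (x * pow_exp p 1 x))%:C.
Proof.
move=> p0 x0; have [K K0 HK] := powR_expR_bounded p0 (@ltr01 R).
apply: (@mellin_inversion _ _ K) => //.
- exact: measurable_pow_exp.
- exact: pow_exp_ge0.
- by move=> y; exact: continuous_pow_exp.
- exact: integrable_pow_exp.
- by move=> y y0; rewrite /pow_exp mulrA mulr_powRB1 ?HK// ltW.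
- exact: integrable_mellin_pow_exp.
Qed.

Lemma cpowN_vline (R : realType) (x a t : R) : 0 < x ->
  cpow x (- (a +i* t)) = (x `^ (- a))%:C * cis (- (t * ln x)).
Proof. by move=> x0; rewrite -mulNr -cpowE. Qed.

Lemma powRN_mul (R : realType) (x a : R) : 0 < x -> x `^ (- a) * x `^ a = 1.
Proof.
by move=> x0; rewrite -powRD ?addNr ?powRr0// eqxx /= gt_eqF.
Qed.

(** Mellin inversion for the weight y^(a-1) e^(-y), multiplied by x^(-a). *)
Lemma cahen_mellin (R : realType) (a x : R) : 0 < a -> 0 < x ->
  integrableC setT (fun t => cpow x (- (a +i* t)) * GammaC (a +i* t)) /\
  integralC setT (fun t => cpow x (- (a +i* t)) * GammaC (a +i* t)) =
    (2 * pi * expR (- x))%:C.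
Proof.
move=> a0 x0.
have E t : cpow x (- (a +i* t)) * GammaC (a +i* t) =
    (x `^ (- a))%:C * (cis (- (t * ln x)) * mellin (pow_exp a 1) t).
  by rewrite cpowN_vline// GammaC_mellin mulrA.
have I := integrableC_cisM (ln x) (integrable_mellin_pow_exp a0).
split.
  by apply: (eq_integrableC _ _ (integrableCZ _ (x `^ (- a))%:C I)) => // t _; rewrite E.
rewrite (funext E) integralCZ// mellin_inversion_pow_exp// -rmorphM; congr (_%:C).
rewrite /pow_exp mul1r (mulrA x) mulr_powRB1 ?(ltW x0)//.
transitivity (2 * pi * (x `^ (- a) * x `^ a) * expR (- x)); first by ring.
by rewrite powRN_mul// mulr1.
Qed.

Lemma integrable_Gamma_product (R : realType) (p q x : R) : 0 < p -> 0 < q ->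
  integrableC setT (fun t => cis (- (t * ln x)) *
    (mellin (pow_exp p 1) t * mellin (pow_exp q 1) (- t))).
Proof.
move=> p0 q0; apply: integrableC_cisM.
have iq := @integrable_pow_exp R q 1 q0 ltr01.
have im := integrable_mellin_pow_exp p0.
set K := 2 * Rintegral (leb R) (pos R) (fun y => `|pow_exp q 1 y|).
apply: (le_integrableC _ _ _ (integrableRZ K _ (normc_integrable _ im))) => //.
  apply: cmeasurableM; first exact: integrableC_measurable im.
  have [m1 m2] := cmeasurable_mellin iq.
  by split; [apply: (measurableT_comp m1)|apply: (measurableT_comp m2)].
move=> t _; rewrite Normc.normcM mulrC ler_pM ?normc_ge0 ?normc_le_absD//.
exact: normc_mellin_le.
Qed.

(** The second Gamma factor is written as Euler's integral over y.  After the
exchange, the integral over t is a Mellin inversion at the point xy, and what is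
left is again an Euler integral, now of scale 1 + x. *)
Lemma Gamma_product (R : realType) (p q x : R) : 0 < p -> 0 < q -> 0 < x ->
  integralC setT (fun t => cis (- (t * ln x)) *
    (mellin (pow_exp p 1) t * mellin (pow_exp q 1) (- t))) =
  (2 * pi * (x `^ p * (1 + x) `^ (- (p + q)) * GammaR (p + q)))%:C.
Proof.
move=> p0 q0 x0.
have iq := @integrable_pow_exp R q 1 q0 ltr01.
have im := integrable_mellin_pow_exp p0.
have x1 : 0 < 1 + x by rewrite addr_gt0.
pose g t := cis (- (t * ln x)) * mellin (pow_exp p 1) t.
pose f (t y : R) := g t * ((pow_exp q 1 y)%:C * cis (- t * ln y)).
transitivity (integralC setT (fun t => integralC (pos R) (f t))).
  apply: eq_integralC => t _; rewrite /f integralCZ//; last exact: integrable_mellin.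
  by rewrite /g -mulrA.
rewrite (@integralC_Fubini R setT (pos R) f _ (pow_exp q 1) _ _ _ (normc_integrable _ im))//.
- transitivity (integralC (pos R) (fun y => (2 * pi * x `^ p * pow_exp (p + q) (1 + x) y)%:C)).
    apply: eq_integralC => y; rewrite set_itv0y => y0.
    rewrite (_ : (f^~ y) = (fun t => (pow_exp q 1 y)%:C * (cis (- (t * ln (x * y))) * mellin (pow_exp p 1) t))).
      rewrite integralCZ//; last exact: integrableC_cisM.
      rewrite mellin_inversion_pow_exp ?mulr_gt0// -rmorphM; congr (_%:C).
      rewrite /pow_exp (_ : p + q - 1 = (q - 1) + p); last ring.
      rewrite (@powRD _ y (q - 1) p); last by rewrite (gt_eqF y0) implybT.
      rewrite (_ : - ((1 + x) * y) = - y + - (x * y)); last ring.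
      rewrite expRD !mul1r (mulrA (x * y)) mulr_powRB1 ?mulr_ge0 ?(ltW x0) ?(ltW y0)//.
      by rewrite powRM ?(ltW x0) ?(ltW y0)//; ring.
    apply/funext => t; rewrite /f /g lnM ?posrE// mulrDr opprD cisD mulNr; ring.
  rewrite integralC_real// RintegralZl//; last by apply: integrable_pow_exp; rewrite ?addr_gt0.
  by rewrite Rintegral_pow_exp ?addr_gt0// !mulrA.
- apply: cmeasurableM.
    have [m1 m2] := cmeasurable_cisM (ln x) (integrableC_measurable im).
    by split; [apply: (measurableT_comp m1)|apply: (measurableT_comp m2)].
  apply: cmeasurableM.
    by apply: cmeasurable_real; apply: measurableT_comp => //; exact: measurable_pow_exp.
  apply: cmeasurable_cis; apply: measurable_funM; first exact: measurableT_comp.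
  by apply: measurableT_comp => //; exact: measurable_ln.
- move=> t y _ _; rewrite /f /g !Normc.normcM !normc_cis normc_real mul1r mulr1.
  by rewrite (ger0_norm (pow_exp_ge0 _ _ _)) ler_wpM2r ?pow_exp_ge0 ?normc_le_absD.
Qed.

(** * Stirling numbers and the Gamma-product integral *)

Lemma stirling2_gt (n k : nat) : (n < k)%N -> stirling2 n k = 0%N.
Proof.
elim: n k => [|n IH] [|k] //=; rewrite ltnS => nk.
by rewrite !IH ?muln0// ltnW.
Qed.

(** The triangle recurrence, moved from the Stirling numbers to the functions g by
summation by parts.  All uses of the Stirling numbers go through this form. *)
Lemma stirling2_sumS (V : pzRingType) (g : nat -> V) (n : nat) :
  \sum_(k < n.+2) (stirling2 n.+1 k)%:R * g k =
  \sum_(k < n.+1) (stirling2 n k)%:R * (k%:R * g k + g k.+1).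
Proof.
under [RHS]eq_bigr do rewrite mulrDr.
rewrite big_split [X in _ = X + _]big_ord_recl/= mul0r mulr0 add0r.
rewrite big_ord_recl/= mul0r add0r.
transitivity (\sum_(k < n.+1) ((k.+1 * stirling2 n k.+1)%:R * g k.+1 +
    (stirling2 n k)%:R * g k.+1)).
  by apply: eq_bigr => k _; rewrite -mulrDl -natrD.
rewrite big_split/=; congr (_ + _).
rewrite big_ord_recr/= stirling2_gt// muln0 mul0r addr0.
by apply: eq_bigr => k _; rewrite mulrA -natrM mulnC.
Qed.

(** Multiplication by s acts on the g k exactly as the recurrence does; the
model case is g k = s (s-1) ... (s-k+1). *)
Lemma stirling2_expansion (V : comPzRingType) (s : V) (g : nat -> V) (n : nat) :
  (forall k, s * g k = g k.+1 + k%:R * g k) ->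
  s ^+ n * g 0%N = \sum_(k < n.+1) (stirling2 n k)%:R * g k.
Proof.
move=> sg; elim: n => [|n IH]; first by rewrite big_ord_recl big_ord0 addr0.
rewrite exprS -mulrA IH mulr_sumr stirling2_sumS; apply: eq_bigr => k _.
by rewrite mulrCA sg addrC.
Qed.

(** The functional equation says that - s acts on (-1)^k Gamma (s + k) as in
[stirling2_expansion]. *)
Lemma exprn_mul_GammaC (R : realType) (n : nat) (s : R[i]) : 0 < complex.Re s ->
  s ^+ n * GammaC s =
  (-1) ^+ n * \sum_(k < n.+1) (stirling2 n k)%:R * ((-1) ^+ k * GammaC (s + k%:R)).
Proof.
move=> s0; have := @stirling2_expansion _ (- s) (fun k => (-1) ^+ k * GammaC (s + k%:R)) n.
move=> <-; first by rewrite expr0 mul1r addr0 mulrA -exprMn mulN1r opprK.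
move=> k; rewrite -natr1 addrA GammaC_add1; last first.
  by rewrite creD (_ : complex.Re k%:R = k%:R) ?ltr_wpDr//; elim: k => //= k IH; rewrite -natr1 creD IH -natr1.
by rewrite exprS; ring.
Qed.

Lemma vline_addn (R : realType) (a : R) (k : nat) (t : R) :
  (a +i* t) + k%:R = (a + k%:R) +i* t :> R[i].
Proof.
elim: k => [|k IH]; first by rewrite addr0 addr0.
by rewrite -natr1 addrA IH -natr1; apply: complex_ext; rewrite /= ?addr0 ?addrA.
Qed.

(** By [exprn_mul_GammaC] the integrand is a combination of n + 1 products of the
type of [Gamma_product], with p = a + k and q = r + 1 - a; so p + q = r + 1 + k
is free of a, and Gamma (r + 1 + k) is the coefficient in omega_(n,r+1). *)
Lemma geom_poly_Gamma_integral (R : realType) (r x : R) (n : nat) (a : R) :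
  0 <= r -> 0 < x -> 0 < a -> a < 1 ->
  let F := fun s : R[i] =>
    cpow x (- s) * s ^+ n * GammaC s * GammaC ((r + 1)%:C - s) in
  vline_integrable a F /\
  (((1 + x) `^ (r + 1))^-1 * (geom_poly n (r + 1)).[- x / (1 + x)])%:C =
  (- 1) ^+ n / (2 * pi%:C * 'i * (GammaR (r + 1))%:C) * vline_integral a F.
Proof.
move=> r0 x0 a0 a1 F.
have q0 : 0 < r + 1 - a by lra.
have ak0 k : 0 < a + k%:R by rewrite ltr_wpDr.
pose c (k : nat) : R := x `^ (- a) * ((-1) ^+ n * ((stirling2 n k)%:R * (-1) ^+ k)).
pose f (k : nat) t := cis (- (t * ln x)) *
    (mellin (pow_exp (a + k%:R) 1) t * mellin (pow_exp (r + 1 - a) 1) (- t)).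
have FE t : F (a +i* t) = \sum_(k < n.+1) (c k)%:C * f k t.
  rewrite /F -[_ * _ * GammaC (a +i* t)]mulrA exprn_mul_GammaC// cpowN_vline//.
  have -> : (r + 1)%:C - (a +i* t) = (r + 1 - a) +i* (- t).
    by apply: complex_ext; rewrite /= ?sub0r.
  rewrite mulr_sumr mulr_sumr mulr_suml; apply: eq_bigr => k _.
  rewrite vline_addn !GammaC_mellin /f /c !rmorphM !rmorphXn rmorphN1 rmorph_nat.
  move: (mellin _ _) (mellin _ _) => A B; ring.
have If k : integrableC setT (f k) by exact: integrable_Gamma_product.
have Icf k : integrableC setT (fun t => (c k)%:C * f k t) by exact: integrableCZ.
split.
  apply: (eq_integrableC _ _ (integrableC_sum _ (index_enum 'I_n.+1) (fun k => Icf k))) => //.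
have x1 : 0 < 1 + x by rewrite addr_gt0.
pose T := \sum_(k < n.+1) (stirling2 n k)%:R * (-1) ^+ k *
  (x ^+ k * ((1 + x) `^ (- (r + 1)) * (1 + x)^-1 ^+ k)) * GammaR (k%:R + (r + 1)).
have -> : vline_integral a F = 'i * ((2 * pi * ((-1) ^+ n * T))%:C).
  congr (_ * _); rewrite (funext FE) integralC_sum// mulrA mulr_sumr rmorph_sum/=.
  apply: eq_bigr => k _; rewrite integralCZ// Gamma_product// -rmorphM; congr (_%:C).
  have -> : a + k%:R + (r + 1 - a) = k%:R + (r + 1) by ring.
  have -> : x `^ (a + k%:R) = x `^ a * x ^+ k.
    by rewrite powRD ?powR_mulrn ?(ltW x0)// (gt_eqF x0) implybT.
  have -> : (1 + x) `^ (- (k%:R + (r + 1))) = (1 + x) `^ (- (r + 1)) * (1 + x)^-1 ^+ k.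
    rewrite (_ : - (k%:R + (r + 1)) = - (r + 1) + - k%:R); last ring.
    by rewrite powRD ?powR_invn ?exprVn ?(ltW x1)// (gt_eqF x1) implybT.
  rewrite /c; transitivity (2 * pi * (-1) ^+ n * ((stirling2 n k)%:R * (-1) ^+ k *
    (x ^+ k * ((1 + x) `^ (- (r + 1)) * (1 + x)^-1 ^+ k)) * GammaR (k%:R + (r + 1))) *
    (x `^ (- a) * x `^ a)); first by ring.
  by rewrite powRN_mul// mulr1.
have i0 : ('i : R[i]) != 0 by exact: neq0Ci.
have p0 : pi%:C != 0 :> R[i] by rewrite fmorph_eq0 gt_eqF// pi_gt0.
have E2 : (-1) ^+ n * (-1) ^+ n = 1 :> R[i] by rewrite -exprMn mulrNN mulr1 expr1n.
have -> : (-1) ^+ n / (2 * pi%:C * 'i * (GammaR (r + 1))%:C) *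
    ('i * (2 * pi * ((-1) ^+ n * T))%:C) = ((GammaR (r + 1))^-1 * T)%:C.
  rewrite !rmorphM/= rmorphXn rmorphN1 rmorph_nat fmorphV.
  rewrite [X in X * _ = _]mulrC invfM [X in X * _ * _ = _]mulrC.
  transitivity (((GammaR (r + 1))%:C)^-1 * T%:C * ((-1) ^+ n * (-1) ^+ n)).
    move: (((GammaR (r + 1))%:C)^-1) (pi%:C) p0 => z P P0; field.
    by rewrite i0 P0.
  by rewrite E2 mulr1.
congr (_%:C); rewrite /geom_poly horner_poly !mulr_sumr; apply: eq_bigr => k _.
by rewrite -powRN exprMn (exprNn x); ring.
Qed.

(** * The power series with coefficients k^n *)

Lemma bounded_nondecreasing_cvg (R : realType) (u : nat -> R) (B : R) :
  (forall n, u n <= u n.+1) -> (forall n, u n <= B) -> cvgn u.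
Proof.
move=> ui uB; apply: nondecreasing_is_cvgn; first exact/nondecreasing_seqP.
by exists B => _ [n _ <-].
Qed.

(** Pascal's rule gives u(N+1) = y (u(N) + v(N)) for the partial sums u, v of
orders j + 1 and j.  Once u is known to converge, which follows from
monotonicity and the bound that the same relation provides, the limit is
determined by a linear equation. *)
Lemma geometric_binomial (R : realType) (y : R) (j : nat) : 0 < y -> y < 1 ->
  \sum_(k < N) 'C(k, j)%:R * y ^+ k @[N --> \oo] --> (1 - y)^-1 * (y / (1 - y)) ^+ j.
Proof.
move=> y0 y1; have D0 : 0 < 1 - y by rewrite subr_gt0.
elim: j => [|j IH].
  rewrite expr0 mulr1.
  have := @cvg_geometric_series R 1 y; rewrite ger0_norm ?(ltW y0)// => /(_ y1).
  rewrite div1r; apply: cvg_trans; apply: near_eq_cvg; apply: nearW => N.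
  rewrite /series/= big_mkord; apply: eq_bigr => k _.
  by rewrite bin0 /geometric/= ?mul1r.
set u := fun N => \sum_(k < N) 'C(k, j.+1)%:R * y ^+ k.
set v := fun N => \sum_(k < N) 'C(k, j)%:R * y ^+ k in IH.
have rec N : u N.+1 = y * (u N + v N).
  rewrite /u big_ord_recl bin0n mul0r add0r -big_split mulr_sumr/=.
  by apply: eq_bigr => k _; rewrite /bump/= add1n binS natrD exprS; ring.
have ui N : u N <= u N.+1.
  by rewrite /u big_ord_recr/= lerDl mulr_ge0// exprn_ge0 ?ltW.
have vi N : v N <= v N.+1.
  by rewrite /v big_ord_recr/= lerDl mulr_ge0// exprn_ge0 ?ltW.
have vB N : v N <= (1 - y)^-1 * (y / (1 - y)) ^+ j.
  rewrite -(cvg_lim _ IH)//; apply: nondecreasing_cvgn_le; last exact: cvgP IH.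
  exact/nondecreasing_seqP.
set L := (1 - y)^-1 * _ in IH vB *.
have uB N : u N <= y * L / (1 - y).
  rewrite ler_pdivlMr//; apply: (@le_trans _ _ (u N.+1 * (1 - y))).
    by rewrite ler_wpM2r// ltW.
  have := ui N; have := vB N; rewrite rec => h1 h2.
  have : y * v N <= y * L by rewrite ler_pM2l.
  have : y * u N <= y * (y * (u N + v N)) by rewrite ler_pM2l.
  by lra.
have cu : cvgn u by exact: (bounded_nondecreasing_cvg ui uB).
have cvu : u N @[N --> \oo] --> limn u by [].
suff E : limn u = (1 - y)^-1 * (y / (1 - y)) ^+ j.+1 by rewrite -E.
have c2 : u N.+1 @[N --> \oo] --> y * (limn u + L).
  under eq_fun do rewrite rec.
  by apply: cvgM; [exact: cvg_cst|exact: cvgD].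
have c3 : u N.+1 @[N --> \oo] --> limn u by rewrite (@cvg_shiftS _ u).
have : limn u = y * (limn u + L).
  by rewrite -[LHS](cvg_lim _ c3)//; exact: cvg_lim c2.
move: (limn u) => l Hl; rewrite exprS.
have -> : (1 - y)^-1 * (y / (1 - y) * (y / (1 - y)) ^+ j) = y * L / (1 - y).
  by rewrite /L; ring.
have D1 : 1 - y != 0 by rewrite gt_eqF.
by apply: (mulIf D1); rewrite divfK//; lra.
Qed.

(** The instance of [stirling2_expansion] with falling factorials. *)
Lemma expn_falling (R : realType) (k n : nat) :
  (k%:R : R) ^+ n = \sum_(j < n.+1) (stirling2 n j)%:R * (k ^_ j)%:R.
Proof.
rewrite -(@stirling2_expansion R k%:R (fun j => (k ^_ j)%:R)) ?ffactn0 ?mulr1//.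
move=> j; rewrite ffactnSr -!natrM -natrD; congr (_%:R).
rewrite [(j * _)%N]mulnC -mulnDr [LHS]mulnC.
(* For j > k truncated subtraction is wrong, but then the falling factorial is 0. *)
have [jk|kj] := leqP j k; first by rewrite subnK.
by rewrite ffact_small.
Qed.

Lemma geom_poly1 (R : realType) (n : nat) (z : R) :
  (geom_poly n 1).[z] = \sum_(j < n.+1) (stirling2 n j * j`!)%:R * z ^+ j.
Proof.
rewrite horner_poly; apply: eq_bigr => j _.
by rewrite GammaR1 invr1 mul1r GammaR_fact natrM.
Qed.

Lemma cvg_sum_seq (R : realType) (I : Type) (s : seq I) (f : I -> nat -> R) (l : I -> R) :
  (forall i, f i n @[n --> \oo] --> l i) ->
  \sum_(i <- s) f i n @[n --> \oo] --> \sum_(i <- s) l i.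
Proof.
move=> fl; elim: s => [|i s IH].
  by under eq_fun do rewrite big_nil; rewrite big_nil; exact: cvg_cst.
by under eq_fun do rewrite big_cons; rewrite big_cons; exact: cvgD.
Qed.

(** Expand k^n in falling factorials k^_j = j! C(k, j), and sum each binomial
series. *)
Lemma power_series_geom (R : realType) (y : R) (n : nat) : 0 < y -> y < 1 ->
  \sum_(k < N) k%:R ^+ n * y ^+ k @[N --> \oo] -->
  (1 - y)^-1 * (geom_poly n 1).[y / (1 - y)].
Proof.
move=> y0 y1.
have E N : \sum_(k < N) k%:R ^+ n * y ^+ k =
    \sum_(j < n.+1) (stirling2 n j * j`!)%:R * \sum_(k < N) 'C(k, j)%:R * y ^+ k.
  under eq_bigr do rewrite expn_falling mulr_suml.
  rewrite exchange_big/=; apply: eq_bigr => j _; rewrite mulr_sumr; apply: eq_bigr => k _.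
  by rewrite -bin_ffact !natrM; ring.
under eq_fun do rewrite E.
rewrite geom_poly1 mulr_sumr.
apply: cvg_sum_seq => j.
rewrite mulrCA; apply: cvgM; first exact: cvg_cst.
exact: geometric_binomial.
Qed.

Lemma cvgC_limn (R : realType) (u : nat -> R[i]) (l : R[i]) : cvgC u l ->
  limn (u : nat -> R[i]^o) = l.
Proof.
move=> [u1 u2]; apply: cvg_lim; first exact: norm_hausdorff.
apply/cvgrPdist_lt => e e0.
have {e0}[e' e'0 ->] : exists2 e' : R, 0 < e' & e = e'%:C.
  move: e0; rewrite ltcE/= => /andP[/eqP e1 e2]; exists (complex.Re e) => //.
  by case: e e1 e2 => a b /= -> _.
have e2 : 0 < e' / 2 by rewrite divr_gt0.
move/cvgrPdist_lt : u1 => /(_ _ e2) h1; move/cvgrPdist_lt : u2 => /(_ _ e2) h2.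
near=> N.
rewrite normc_def ltcR.
apply: (@le_lt_trans _ _ (Normc.normc (l - u N))).
  by case: (l - u N).
apply: (le_lt_trans (normc_le_absD _)).
rewrite [ltRHS]splitr ltrD//.
  rewrite (_ : complex.Re (l - u N) = complex.Re l - complex.Re (u N)); first by near: N.
  by case: (l) (u N) => a b [].
rewrite (_ : complex.Im (l - u N) = complex.Im l - complex.Im (u N)); first by near: N.
by case: (l) (u N) => a b [].
Unshelve. all: end_near. Qed.

(** * The Dirichlet series and the zeta integral *)

(** This is the comparison of y^(-b) with its integral over [y, y+1]; the
proof uses only Bernoulli's inequality for (y/(y+1))^(1-b). *)
Lemma powRN_telescope (R : realType) (b y : R) : 1 < b -> 0 < y ->
  (y + 1) `^ (- b) <= (b - 1)^-1 * (y `^ (1 - b) - (y + 1) `^ (1 - b)).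
Proof.
move=> b1 y0; have y1 : 0 < y + 1 by rewrite addr_gt0.
have b0 : 0 < b - 1 by rewrite subr_gt0.
rewrite mulrC ler_pdivlMr//.
have E1 : (y + 1) `^ (1 - b) = (y + 1) * (y + 1) `^ (- b).
  by rewrite powRD ?powRr1 ?(ltW y1)// (gt_eqF y1) implybT.
set q := y / (y + 1).
have q0 : 0 < q by rewrite divr_gt0.
have E2 : y `^ (1 - b) = (y + 1) `^ (1 - b) * q `^ (1 - b).
  rewrite -powRM ?(ltW y1) ?(ltW q0)//; congr (_ `^ _).
  by rewrite /q mulrC divfK// gt_eqF.
(* Bernoulli's inequality, from e^u >= 1 + u and ln q <= q - 1. *)
have E3 : 1 + (b - 1) * (1 - q) <= q `^ (1 - b).
  rewrite powRE_gt0// (le_trans _ (expR_ge1Dx _))// lerD2l.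
  have : ln q <= q - 1.
    by rewrite -{1}(subrKC 1 q) le_ln1Dx// ltrBrDl subrr.
  move=> h; have : (b - 1) * ln q <= (b - 1) * (q - 1) by rewrite ler_pM2l.
  by lra.
have E4 : (1 - q) * (y + 1) = 1 by rewrite /q mulrBl divfK ?gt_eqF//; ring.
have P0 : 0 < (y + 1) `^ (- b) by rewrite powR_gt0.
rewrite E2 E1; move: ((y + 1) `^ (- b)) P0 (q `^ (1 - b)) E3 => P P0 Q E3.
have -> : (y + 1) * P * Q - (y + 1) * P = P * ((y + 1) * (Q - 1)) by ring.
rewrite ler_pM2l//; apply: (@le_trans _ _ ((y + 1) * ((b - 1) * (1 - q)))).
  rewrite mulrCA [(y + 1) * _]mulrC E4; lra.
by rewrite ler_pM2l//; lra.
Qed.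

(** Telescoping [powRN_telescope]; any bound that does not depend on N would
do. *)
Lemma zeta_bound (R : realType) (b : R) (N : nat) : 1 < b ->
  \sum_(k < N) k.+1%:R `^ (- b) <= 1 + (b - 1)^-1.
Proof.
move=> b1; have b0 : 0 < b - 1 by rewrite subr_gt0.
suff H M : \sum_(k < M.+1) k.+1%:R `^ (- b) <= 1 + (b - 1)^-1 * (1 - M.+1%:R `^ (1 - b)).
  case: N => [|N]; first by rewrite big_ord0 addr_ge0// invr_ge0 ltW.
  apply: (le_trans (H N)); rewrite lerD2l; apply: ler_piMr.
    by rewrite invr_ge0 ltW.
  by rewrite gerBl powR_ge0.
elim: M => [|M IH]; first by rewrite big_ord_recl big_ord0 !powR1 subrr mulr0.
rewrite big_ord_recr/=.
have := @powRN_telescope R b M.+1%:R b1 (ltr0Sn _ _).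
rewrite natr1 => h; have := lerD IH h; lra.
Qed.

Lemma normc_cpow (R : realType) (x b t : R) : 0 < x ->
  Normc.normc (cpow x (b +i* t)) = x `^ b.
Proof.
by move=> x0; rewrite cpowE// Normc.normcM normc_cis normc_real mulr1 ger0_norm ?powR_ge0.
Qed.

Definition zeta_partial (R : realType) (s : R[i]) (N : nat) : R[i] :=
  \sum_(k < N) cpow k.+1%:R (- s).

Lemma normc_sum (R : realType) (I : Type) (r : seq I) (f : I -> R[i]) :
  Normc.normc (\sum_(i <- r) f i) <= \sum_(i <- r) Normc.normc (f i).
Proof.
elim: r => [|i r IH]; first by rewrite !big_nil Normc.normc0.
by rewrite !big_cons (le_trans (le_normcD _ _))// lerD2l.
Qed.

Lemma zeta_partial_bound (R : realType) (b t : R) (N : nat) : 1 < b ->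
  Normc.normc (zeta_partial (b +i* t) N) <= 1 + (b - 1)^-1.
Proof.
move=> b1; apply: (le_trans (normc_sum _ _)).
apply: le_trans (zeta_bound N b1).
by apply: ler_sum => k _; rewrite (normc_cpow (- b) (- t)).
Qed.

Lemma cvg_series_dominated (R : realType) (u v : nat -> R) (B : R) :
  (forall k, `|u k| <= v k) -> (forall N, \sum_(k < N) v k <= B) ->
  cvgn (fun N => \sum_(k < N) u k).
Proof.
move=> uv vB.
have : cvgn (series u).
  apply: normed_cvg; apply: (@bounded_nondecreasing_cvg _ _ B).
    by move=> N; rewrite /= seriesSr lerDl normr_ge0.
  move=> N; rewrite /= /series/= big_mkord (le_trans _ (vB N))//.
  by apply: ler_sum.
rewrite /series/=; under eq_fun do rewrite big_mkord.
by [].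
Qed.

Lemma Re_sum (R : realType) (I : Type) (r : seq I) (f : I -> R[i]) :
  complex.Re (\sum_(i <- r) f i) = \sum_(i <- r) complex.Re (f i).
Proof. by elim: r => [|i r IH]; rewrite ?big_nil// !big_cons creD IH. Qed.

Lemma Im_sum (R : realType) (I : Type) (r : seq I) (f : I -> R[i]) :
  complex.Im (\sum_(i <- r) f i) = \sum_(i <- r) complex.Im (f i).
Proof. by elim: r => [|i r IH]; rewrite ?big_nil// !big_cons cimD IH. Qed.

(** Absolute convergence, since the modulus of the k-th term is (k+1)^(-b).  It
also shows that the limit in the definition of [zetaC] exists. *)
Lemma cvg_zeta_partial (R : realType) (b t : R) : 1 < b ->
  cvgC (zeta_partial (b +i* t)) (zetaC (b +i* t)).
Proof.
move=> b1; pose u := zeta_partial (b +i* t).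
have nb (k : nat) : Normc.normc (cpow k.+1%:R (- (b +i* t))) <= k.+1%:R `^ (- b).
  by rewrite (normc_cpow (- b) (- t)).
have c1 : cvgn (fun N => complex.Re (u N)).
  under eq_fun do rewrite /u /zeta_partial Re_sum.
  apply: (@cvg_series_dominated _ (fun k => complex.Re (cpow k.+1%:R (- (b +i* t)))) (fun k => k.+1%:R `^ (- b)) _ _ (fun N => zeta_bound N b1)) => k.
  exact: le_trans (normc_ge_absRe _) (nb k).
have c2 : cvgn (fun N => complex.Im (u N)).
  under eq_fun do rewrite /u /zeta_partial Im_sum.
  apply: (@cvg_series_dominated _ (fun k => complex.Im (cpow k.+1%:R (- (b +i* t)))) (fun k => k.+1%:R `^ (- b)) _ _ (fun N => zeta_bound N b1)) => k.
  exact: le_trans (normc_ge_absIm _) (nb k).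
have cu : cvgC u (limn (fun N => complex.Re (u N)) +i* limn (fun N => complex.Im (u N))).
  by split.
have <- // : limn (u : nat -> R[i]^o) = zetaC (b +i* t).
  congr (limn _); apply/funext => N.
  by rewrite /u /zeta_partial big_add1/= big_mkord.
by rewrite (cvgC_limn cu).
Qed.

Lemma cvgCM (R : realType) (c : R[i]) (u : nat -> R[i]) (l : R[i]) :
  cvgC u l -> cvgC (fun n => c * u n) (c * l).
Proof.
move=> [u1 u2]; split.
  under eq_fun do rewrite creM; rewrite creM.
  by apply: cvgB; apply: cvgM => //; exact: cvg_cst.
under eq_fun do rewrite cimM; rewrite cimM.
by apply: cvgD; apply: cvgM => //; exact: cvg_cst.
Qed.

Lemma cvgC_real (R : realType) (u : nat -> R) (l : R) :
  u n @[n --> \oo] --> l -> cvgC (fun n => (u n)%:C) l%:C.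
Proof. by move=> ul; split => //=; exact: cvg_cst. Qed.

(** Replacing zeta by its partial sums FN, each term k^n (kx)^(-s) Gamma s is
integrated by [cahen_mellin].  On the line the partial sums are uniformly
bounded, so that a multiple of |Gamma| dominates and the limit can be taken under the
integral. *)
Lemma geom_poly_zeta_integral (R : realType) (x : R) (n : nat) (a : R) :
  0 < x -> n%:R + 1 < a ->
  let F := fun s : R[i] => cpow x (- s) * zetaC (s - n%:R) * GammaC s in
  vline_integrable a F /\
  (expR x / (expR x - 1) * (geom_poly n 1).[1 / (expR x - 1)])%:C =
  (n == 0%N)%:R + (2 * pi%:C * 'i)^-1 * vline_integral a F.
Proof.
move=> x0 na F.
have a0 : 0 < a by apply: lt_trans na; rewrite ltr_wpDl.
have b1 : 1 < a - n%:R by rewrite ltrBrDl.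
have sub t : (a +i* t) - n%:R = (a - n%:R) +i* t.
  by rewrite -[a in LHS](subrK n%:R) -vline_addn addrK.
pose FN N t := cpow x (- (a +i* t)) * zeta_partial ((a +i* t) - n%:R) N * GammaC (a +i* t).
pose h (k : nat) t := cpow (k.+1%:R * x) (- (a +i* t)) * GammaC (a +i* t).
have hi k := cahen_mellin a0 (mulr_gt0 (ltr0Sn R k) x0).
have FNE N t : FN N t = \sum_(k < N) (k.+1%:R ^+ n)%:C * h k t.
  rewrite /FN /zeta_partial mulr_sumr mulr_suml; apply: eq_bigr => k _.
  rewrite sub mulrA; congr (_ * _).
  rewrite !cpowN_vline ?mulr_gt0//.
  have -> : cis (- (t * ln (k.+1%:R * x))) = cis (- (t * ln k.+1%:R)) * cis (- (t * ln x)).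
    by rewrite -cisD lnM ?posrE// mulrDr opprD.
  rewrite powRM ?(ltW x0)// opprB powRD; last by rewrite pnatr_eq0 implybT.
  by rewrite powR_mulrn// !rmorphM; ring.
have FNi N : integrableC setT (FN N) /\ integralC setT (FN N) =
    (2 * pi * \sum_(k < N) k.+1%:R ^+ n * expR (- x) ^+ k.+1)%:C.
  have ih k : integrableC setT (fun t => (k.+1%:R ^+ n)%:C * h k t).
    by apply: integrableCZ => //; exact: (hi k).1.
  rewrite (funext (FNE N)); split; first exact: integrableC_sum.
  rewrite integralC_sum// mulr_sumr rmorph_sum; apply: eq_bigr => k _.
  rewrite integralCZ//; last exact: (hi k).1.
  rewrite (hi k).2 -rmorphM -mulrN expRM_natl; congr (_%:C); ring.
have iG : integrableC setT (fun t => GammaC (a +i* t)).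
  by rewrite (funext (GammaC_mellin a)); exact: integrable_mellin_pow_exp.
have [iF cF] : integrableC setT (fun t => F (a +i* t)) /\
    cvgC (fun N => integralC setT (FN N)) (integralC setT (fun t => F (a +i* t))).
  apply: (@dominated_cvgC _ _ _ FN _ _ _ _
    (integrableRZ (x `^ (- a) * (1 + (a - n%:R - 1)^-1)) _ (normc_integrable _ iG))) => //.
  - by move=> N; exact: integrableC_measurable (FNi N).1.
  - move=> t _; rewrite /FN /F; under eq_fun do rewrite mulrAC.
    rewrite mulrAC; apply: cvgCM; rewrite sub; exact: cvg_zeta_partial.
  - move=> N t _; rewrite /FN !Normc.normcM (normc_cpow (- a) (- t))//.
    rewrite -!mulrA ler_wpM2l ?powR_ge0// ler_pM ?normc_ge0 ?normc_le_absD//.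
    by rewrite sub zeta_partial_bound.
split=> //.
have y0 : 0 < expR (- x) by exact: expR_gt0.
have y1 : expR (- x) < 1 by rewrite expR_lt1 oppr_lt0.
pose L := (1 - expR (- x))^-1 * (geom_poly n 1).[expR (- x) / (1 - expR (- x))].
(* Dropping the term k = 0, which is 0^n. *)
have cL : \sum_(k < N) k.+1%:R ^+ n * expR (- x) ^+ k.+1 @[N --> \oo] --> L - (n == 0%N)%:R.
  have := @power_series_geom R _ n y0 y1.
  rewrite -cvg_shiftS/=; under eq_fun do rewrite big_ord_recl/= expr0 mulr1 expr0n.
  move=> H; apply: cvg_trans (cvgB H (cvg_cst ((n == 0%N)%:R : R))).
  apply: near_eq_cvg; apply: nearW => N.
  by rewrite !fctE addrAC subrr add0r.
have IE : integralC setT (fun t => F (a +i* t)) = (2 * pi * (L - (n == 0%N)%:R))%:C.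
  apply: cvgC_unique cF _; under eq_fun do rewrite (FNi _).2.
  by apply: cvgC_real; apply: cvgM => //; exact: cvg_cst.
have E0 : expR x != 0 by rewrite gt_eqF// expR_gt0.
have E1 : expR x - 1 != 0 by rewrite gt_eqF// subr_gt0 expR_gt1.
have -> : (expR x / (expR x - 1) * (geom_poly n 1).[1 / (expR x - 1)])%:C = L%:C.
  congr (_%:C); rewrite /L expRN; congr (_ * _.[_]); field; by rewrite E1 E0.
rewrite /vline_integral IE.
have i0 : ('i : R[i]) != 0 by exact: neq0Ci.
have p0 : pi%:C != 0 :> R[i] by rewrite fmorph_eq0 gt_eqF// pi_gt0.
clearbody L; rewrite !rmorphM rmorphB !rmorph_nat/=.
move: (pi%:C) p0 => P P0; field.
by rewrite i0 P0.
Qed.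

(** * The partial fractions of coth, by real integrals *)

Definition cosh (R : realType) (u : R) : R := (expR u + expR (- u)) / 2.

Lemma is_derive_cosh (R : realType) (u : R) : is_derive u 1 (@cosh R) (sinh u).
Proof. by apply: is_derive_eq; rewrite /sinh /GRing.scale/=; ring. Qed.

Lemma is_derive_sinh (R : realType) (u : R) : is_derive u 1 (@sinh R) (cosh u).
Proof. by apply: is_derive_eq; rewrite /cosh /GRing.scale/=; ring. Qed.

#[local] Existing Instance is_derive_cosh.
#[local] Existing Instance is_derive_sinh.

Lemma continuous_is_derive (R : realType) (f f' : R -> R) :
  (forall x : R, is_derive x 1 f (f' x)) -> continuous f.
Proof.
move=> df x; apply/differentiable_continuous/derivable1_diffP.
by have [] := df x.
Qed.

Lemma integrable_quarter (R : realType) (f : R -> R) : continuous f ->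
  integrableR (quarter R) f.
Proof.
move=> cf; apply: continuous_compact_integrable; first exact: segment_compact.
exact: continuous_subspaceT.
Qed.

Lemma Rintegral_quarter (R : realType) (f F : R -> R) : continuous f ->
  (forall x : R, is_derive x 1 F (f x)) ->
  Rintegral (leb R) (quarter R) f = F (pi / 2) - F 0.
Proof.
move=> cf dF; have cF := continuous_is_derive dF.
rewrite /Rintegral (@continuous_FTC2 _ f F) ?EFinB//.
- by rewrite divr_gt0 ?pi_gt0.
- exact: continuous_subspaceT.
- split.
  + by move=> x _; have [] := dF x.
  + by apply: cvg_at_right_filter; exact: cF.
  + by apply: cvg_at_left_filter; exact: cF.
- by move=> x _; rewrite derive1E; have [_ ->] := dF x.
Qed.

(** The integrals of cosh (zt) cos^n t and of its derivative in z satisfy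
two-step recurrences in n. *)
Definition cosh_cos (R : realType) (z : R) (n : nat) (t : R) : R := cosh (z * t) * cos t ^+ n.
Definition sinh_cos (R : realType) (z : R) (n : nat) (t : R) : R := t * sinh (z * t) * cos t ^+ n.
Definition I_cosh (R : realType) (z : R) (n : nat) : R :=
  Rintegral (leb R) (quarter R) (cosh_cos z n).
Definition I_sinh (R : realType) (z : R) (n : nat) : R :=
  Rintegral (leb R) (quarter R) (sinh_cos z n).

Lemma continuous_cosh_cos (R : realType) (z : R) (n : nat) : continuous (cosh_cos z n).
Proof.
move=> t; apply: cvgM.
  apply: (@continuous_comp R R R (fun t => z * t) (@cosh R)).
    by apply: cvgM; [exact: cvg_cst|exact: cvg_id].
  exact: (continuous_is_derive (@is_derive_cosh R)).
apply: (@continuous_comp R R R (@cos R) (fun u => u ^+ n)); first exact: continuous_cos.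
exact: exprn_continuous.
Qed.

Lemma continuous_sinh_cos (R : realType) (z : R) (n : nat) : continuous (sinh_cos z n).
Proof.
move=> t; apply: cvgM.
  apply: cvgM; first exact: cvg_id.
  apply: (@continuous_comp R R R (fun t => z * t) (@sinh R)).
    by apply: cvgM; [exact: cvg_cst|exact: cvg_id].
  exact: (continuous_is_derive (@is_derive_sinh R)).
apply: (@continuous_comp R R R (@cos R) (fun u => u ^+ n)); first exact: continuous_cos.
exact: exprn_continuous.
Qed.

Lemma is_derive_scale (R : realType) (z t l : R) (f : R -> R) :
  is_derive (z * t) 1 f l -> is_derive t 1 (fun t => f (z * t)) (z * l).
Proof.
move=> df; have dz : is_derive t 1 (fun t : R => z * t) z.
  by apply: is_derive_eq; rewrite /GRing.scale/=; ring.
have := @is_derive1_comp R f (fun t => z * t) t l z df dz.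
by rewrite mulrC.
Qed.

Lemma is_derive_cosX (R : realType) (n : nat) (t : R) :
  is_derive t 1 (fun t => cos t ^+ n.+1) (- (n.+1%:R * cos t ^+ n * sin t)).
Proof.
have := is_deriveX n.+1 (is_derive_cos t).
by rewrite exprfctE /GRing.scale/= mulrN.
Qed.

(** The letters a, b, p, q stand for cosh (zt), sinh (zt), cos^(n+2) t and
cos^(n+1) t. *)
Lemma primitive_cosh_derive (R : realType) (z N : R) (a b p q : R -> R) (t a' b' p' q' : R) :
  is_derive t 1 a a' -> is_derive t 1 b b' -> is_derive t 1 p p' -> is_derive t 1 q q' ->
  is_derive t 1 (fun t => z * b t * p t + N * a t * q t * sin t)
    (z * b' * p t + z * b t * p' + N * a' * q t * sin t + N * a t * q' * sin t +
     N * a t * q t * cos t).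
Proof.
move=> da db dp dq; apply: is_derive_eq; rewrite /GRing.scale/=; ring.
Qed.

(** Two integrations by parts, combined into one primitive that vanishes at both
ends of [0, pi/2]. *)
Lemma I_cosh_rec (R : realType) (z : R) (n : nat) :
  (n.+2%:R ^+ 2 + z ^+ 2) * I_cosh z n.+2 = n.+2%:R * n.+1%:R * I_cosh z n.
Proof.
have ic k := integrable_quarter (@continuous_cosh_cos R z k).
suff : Rintegral (leb R) (quarter R) (fun t => (n.+2%:R ^+ 2 + z ^+ 2) * cosh_cos z n.+2 t -
    n.+2%:R * n.+1%:R * cosh_cos z n t) = 0.
  rewrite RintegralB//; try exact: integrableRZ.
  by rewrite !RintegralZl// => /subr0_eq.
pose F (t : R) := z * sinh (z * t) * cos t ^+ n.+2 +
  n.+2%:R * cosh (z * t) * cos t ^+ n.+1 * sin t.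
transitivity (F (pi / 2) - F 0); last first.
  by rewrite /F cos_pihalf !expr0n/= !(mulr0, mul0r) sin0 /sinh oppr0 subrr; ring.
apply: Rintegral_quarter.
- move=> t; apply: cvgB; (apply: cvgM; [exact: cvg_cst|exact: continuous_cosh_cos]).
- move=> t; rewrite /F.
  have dp := is_derive_cosX n.+1 t; have dq := is_derive_cosX n t.
  have da := is_derive_scale (is_derive_cosh (z * t)).
  have db := is_derive_scale (is_derive_sinh (z * t)).
  apply: (is_derive_eq (@primitive_cosh_derive R z n.+2%:R _ _ _ _ t _ _ _ _ da db dp dq)).
  rewrite /cosh_cos -(natr1 n.+1) (exprSr (cos t) n.+1) (exprSr (cos t) n).
  have := congr1 (fun u => (n.+1%:R + 1) * n.+1%:R * cosh (z * t) * cos t ^+ n * u) (cos2Dsin2 t).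
  move: (n.+1%:R : R) (cos t ^+ n) (cos t) (sin t) (cosh _) (sinh _) => m C c s a b /=.
  by lra.
Qed.

Lemma primitive_sinh_derive (R : realType) (z N : R) (a b p q : R -> R) (t a' b' p' q' : R) :
  is_derive t 1 a a' -> is_derive t 1 b b' -> is_derive t 1 p p' -> is_derive t 1 q q' ->
  is_derive t 1 (fun t => (b t + z * t * a t) * p t + N * t * b t * q t * sin t)
    ((b' + z * a t + z * t * a') * p t + (b t + z * t * a t) * p' +
     N * b t * q t * sin t + N * t * b' * q t * sin t + N * t * b t * q' * sin t +
     N * t * b t * q t * cos t).
Proof.
move=> da db dp dq; apply: is_derive_eq; rewrite /GRing.scale/=; ring.
Qed.

(** The derivative in z of [I_cosh_rec], obtained directly from an explicit
primitive. *)
Lemma I_sinh_rec (R : realType) (z : R) (n : nat) :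
  (n.+2%:R ^+ 2 + z ^+ 2) * I_sinh z n.+2 + 2 * z * I_cosh z n.+2 =
  n.+2%:R * n.+1%:R * I_sinh z n.
Proof.
have ic k := integrable_quarter (@continuous_cosh_cos R z k).
have is_ k := integrable_quarter (@continuous_sinh_cos R z k).
suff : Rintegral (leb R) (quarter R) (fun t => (n.+2%:R ^+ 2 + z ^+ 2) * sinh_cos z n.+2 t +
    2 * z * cosh_cos z n.+2 t - n.+2%:R * n.+1%:R * sinh_cos z n t) = 0.
  rewrite RintegralB//; try exact: integrableRZ; last first.
    by apply: integrableRD => //; exact: integrableRZ.
  rewrite RintegralD//; try exact: integrableRZ.
  by rewrite !RintegralZl// => /subr0_eq.
pose F (t : R) := (sinh (z * t) + z * t * cosh (z * t)) * cos t ^+ n.+2 +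
  n.+2%:R * t * sinh (z * t) * cos t ^+ n.+1 * sin t.
transitivity (F (pi / 2) - F 0); last first.
  by rewrite /F cos_pihalf !expr0n/= !(mulr0, mul0r) ?sin0 /sinh oppr0 subrr; ring.
apply: Rintegral_quarter.
- move=> t; apply: cvgB; first apply: cvgD.
  + by apply: cvgM; [exact: cvg_cst|exact: continuous_sinh_cos].
  + by apply: cvgM; [exact: cvg_cst|exact: continuous_cosh_cos].
  + by apply: cvgM; [exact: cvg_cst|exact: continuous_sinh_cos].
- move=> t; rewrite /F.
  have dp := is_derive_cosX n.+1 t; have dq := is_derive_cosX n t.
  have da := is_derive_scale (is_derive_cosh (z * t)).
  have db := is_derive_scale (is_derive_sinh (z * t)).
  apply: (is_derive_eq (@primitive_sinh_derive R z n.+2%:R _ _ _ _ t _ _ _ _ da db dp dq)).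
  rewrite /cosh_cos /sinh_cos -(natr1 n.+1) (exprSr (cos t) n.+1) (exprSr (cos t) n).
  have := congr1 (fun u => (n.+1%:R + 1) * n.+1%:R * t * sinh (z * t) * cos t ^+ n * u) (cos2Dsin2 t).
  move: (n.+1%:R : R) (cos t ^+ n) (cos t) (sin t) (cosh _) (sinh _) => m C c s a b /=.
  by lra.
Qed.

Lemma I_cosh0 (R : realType) (z : R) : z != 0 -> I_cosh z 0 = sinh (z * (pi / 2)) / z.
Proof.
move=> z0; pose F (t : R) := sinh (z * t) / z.
transitivity (F (pi / 2) - F 0); last by rewrite /F mulr0 /sinh oppr0 subrr !mul0r subr0.
apply: Rintegral_quarter; first exact: continuous_cosh_cos.
move=> t; have db := is_derive_scale (is_derive_sinh (z * t)).
rewrite /F /cosh_cos; move: (fun t => sinh _) db => b db.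
by apply: is_derive_eq; rewrite /GRing.scale/=; field.
Qed.

Lemma I_sinh0 (R : realType) (z : R) : z != 0 ->
  I_sinh z 0 = pi / 2 * cosh (z * (pi / 2)) / z - sinh (z * (pi / 2)) / z ^+ 2.
Proof.
move=> z0; pose F (t : R) := t * cosh (z * t) / z - sinh (z * t) / z ^+ 2.
transitivity (F (pi / 2) - F 0); last by rewrite /F mulr0 /sinh oppr0 subrr !mul0r !subr0.
apply: Rintegral_quarter; first exact: continuous_sinh_cos.
move=> t; have db := is_derive_scale (is_derive_sinh (z * t)).
have da := is_derive_scale (is_derive_cosh (z * t)).
rewrite /F /sinh_cos.
have H (a b : R -> R) : is_derive t 1 a (z * sinh (z * t)) -> is_derive t 1 b (z * a t) ->
    is_derive t 1 (fun t => t * a t / z - b t / z ^+ 2) (t * sinh (z * t)).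
  by move=> da' db'; apply: is_derive_eq; rewrite /GRing.scale/=; field.
by rewrite expr0 mulr1; exact: (H _ _ da db).
Qed.

Lemma cosh_ge1 (R : realType) (u : R) : 1 <= cosh u.
Proof. by rewrite /cosh; have := expR_ge1Dx u; have := expR_ge1Dx (- u); lra. Qed.

Lemma sinh_ge0 (R : realType) (u : R) : 0 <= u -> 0 <= sinh u.
Proof. by move=> u0; rewrite /sinh divr_ge0// subr_ge0 ler_expR; lra. Qed.

Lemma sinh_le (R : realType) (u : R) : sinh u <= u * expR u.
Proof.
rewrite /sinh; have := expR_ge1Dx (- (2 * u)).
have -> : expR (- u) = expR u * expR (- (2 * u)) by rewrite -expRD; congr expR; ring.
have := expR_gt0 u; move: (expR u) (expR (- (2 * u))) => e f e0 h.
have : e * (1 + - (2 * u)) <= e * f by rewrite ler_pM2l.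
by lra.
Qed.

Lemma quarter_cos_ge0 (R : realType) (t : R) : 0 <= t <= pi / 2 -> 0 <= cos t.
Proof.
move=> /andP[t0 t1]; apply: cos_ge0_pihalf; rewrite t1 andbT.
by have := @pi_gt0 R; lra.
Qed.

(** The mean value theorem, as the cosine decreases on [0, pi/2]. *)
Lemma mul_cos_le_sin (R : realType) (t : R) : 0 <= t <= pi / 2 -> t * cos t <= sin t.
Proof.
move=> /andP[]; rewrite le_eqVlt => /predU1P[<- _|t0 t1]; first by rewrite mul0r sin0.
have pi0 := @pi_gt0 R.
have [c] : exists2 c, c \in `]0, t[ & sin t - sin 0 = cos c * (t - 0).
  apply: (@MVT R (@sin R) (@cos R) 0 t t0).
  apply: continuous_subspaceT; exact: continuous_sin.
rewrite in_itv/= => /andP[c0 ct]; rewrite sin0 !subr0 => ->.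
rewrite mulrC ler_pM2r//; apply: ltW; rewrite ltr_cos ?in_itv//=; lra.
Qed.

(** Since t cos t <= sin t, the integrand of I_sinh at n + 2 is at most a constant
times cos^n t sin^2 t, which is a difference of two Wallis integrands. *)
Lemma sinh_cos_le (R : realType) (z t : R) (n : nat) : 0 < z -> 0 <= t <= pi / 2 ->
  sinh_cos z n.+2 t <= z * expR (z * (pi / 2)) * (cosh_cos 0 n t - cosh_cos 0 n.+2 t).
Proof.
move=> z0 tq; have /andP[t0 t1] := tq.
rewrite /sinh_cos /cosh_cos mul0r /cosh oppr0 expR0 divff// !mul1r.
have c0 := quarter_cos_ge0 tq; have h1 := mul_cos_le_sin tq.
rewrite (exprSr _ n.+1) (exprSr _ n).
have h2 : (t * cos t) * (t * cos t) <= 1 - cos t ^+ 2.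
  by rewrite -sin2cos2 expr2 ler_pM// mulr_ge0.
set E := expR _.
have h3 : sinh (z * t) <= z * t * E.
  apply: (le_trans (sinh_le _)); rewrite ler_wpM2l ?mulr_ge0 ?(ltW z0)//.
  by rewrite ler_expR ler_pM2l.
have E0 : 0 <= E by exact: expR_ge0.
have C0 : 0 <= cos t ^+ n by rewrite exprn_ge0.
move: (cos t ^+ n) C0 (sinh _) h3 => C C0 S h3.
have -> : t * S * (C * cos t * cos t) = C * (S * (t * cos t * cos t)) by ring.
have -> : z * E * (C - C * cos t * cos t) = C * (z * E * (1 - cos t ^+ 2)) by ring.
rewrite ler_wpM2l//.
apply: (@le_trans _ _ (z * t * E * (t * cos t * cos t))).
  by rewrite ler_wpM2r// !mulr_ge0.
have -> : z * t * E * (t * cos t * cos t) = z * E * ((t * cos t) * (t * cos t)) by ring.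
by rewrite ler_wpM2l// mulr_ge0// ltW.
Qed.

Lemma I_cosh_ge_at0 (R : realType) (z : R) (n : nat) : I_cosh 0 n <= I_cosh z n.
Proof.
apply: le_Rintegral => //; try exact/integrable_quarter/continuous_cosh_cos.
move=> t /=; rewrite in_itv/= => tq; rewrite /cosh_cos ler_wpM2r ?exprn_ge0 ?quarter_cos_ge0//.
by rewrite mul0r {1}/cosh oppr0 expR0 divff// cosh_ge1.
Qed.

(** The recurrence of the Wallis integrals. *)
Lemma I_cosh_at0_rec (R : realType) (n : nat) :
  n.+2%:R * I_cosh (0 : R) n.+2 = n.+1%:R * I_cosh 0 n.
Proof.
have := @I_cosh_rec R 0 n; rewrite expr0n/= addr0 expr2 -!mulrA.
by move=> /mulfI -> //; rewrite pnatr_eq0.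
Qed.

Lemma I_cosh_at0_gt0 (R : realType) (m : nat) : 0 < I_cosh (0 : R) m.*2.
Proof.
elim: m => [|m IH].
  rewrite (_ : I_cosh 0 0 = pi / 2) ?divr_gt0 ?pi_gt0//.
  rewrite -[RHS]subr0; apply: (@Rintegral_quarter R _ id); first exact: continuous_cosh_cos.
  move=> t; rewrite /cosh_cos mul0r /cosh oppr0 expR0 divff// mulr1.
  exact: is_derive_id.
rewrite doubleS -(@pmulr_rgt0 _ m.*2.+2%:R)// I_cosh_at0_rec.
by rewrite mulr_gt0.
Qed.

Lemma I_cosh_gt0 (R : realType) (z : R) (m : nat) : 0 < I_cosh z m.*2.
Proof. exact: lt_le_trans (I_cosh_at0_gt0 R m) (I_cosh_ge_at0 z _). Qed.

Lemma I_sinh_ge0 (R : realType) (z : R) (n : nat) : 0 <= z -> 0 <= I_sinh z n.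
Proof.
move=> z0; apply: Rintegral_ge0 => t /=; rewrite in_itv/= => tq.
have /andP[t0 _] := tq; apply: mulr_ge0; last by rewrite exprn_ge0 ?quarter_cos_ge0.
by apply: mulr_ge0 => //; apply: sinh_ge0; exact: mulr_ge0.
Qed.

Definition ratio_I (R : realType) (z : R) (m : nat) : R := I_sinh z m.*2 / I_cosh z m.*2.

(** Dividing [I_sinh_rec] by [I_cosh_rec]: passing from n to n + 2 changes the
quotient exactly by one partial fraction. *)
Lemma ratio_I_step (R : realType) (z : R) (m : nat) :
  ratio_I z m = ratio_I z m.+1 + 2 * z / ((2 * m.+1%:R) ^+ 2 + z ^+ 2).
Proof.
rewrite /ratio_I doubleS.
have H0 := I_cosh_gt0 z m; have H2 := I_cosh_gt0 z m.+1; rewrite doubleS in H2.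
have := @I_cosh_rec R z m.*2; have := @I_sinh_rec R z m.*2.
have -> : (m.*2.+2%:R : R) = 2 * m.+1%:R by rewrite -natrM mul2n doubleS.
have N0 : 0 < 2 * m.+1%:R * m.*2.+1%:R :> R by rewrite !mulr_gt0.
have D0 : 0 < (2 * m.+1%:R) ^+ 2 + z ^+ 2 by rewrite ltr_pwDl ?sqr_ge0// exprn_gt0// mulr_gt0.
move: (2 * m.+1%:R * m.*2.+1%:R) N0 (_ ^+ 2 + _) D0 H0 H2.
move: (I_sinh _ _) (I_sinh _ _) (I_cosh _ _) (I_cosh _ _) => a b c d N N0 D D0 c0 d0 hs hc.
(* N is the common factor n (n - 1) on the right of the two recurrences. *)
have -> : a / d = (N * a) / (N * d) by field; rewrite !gt_eqF.
by rewrite -hs -hc; field; rewrite !gt_eqF.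
Qed.

(** The integral I_cosh z n is at least the Wallis integral I_cosh 0 n, and by
[sinh_cos_le] the numerator is at most a constant times the decrement of the
Wallis integrals, which is O(1/n) relative to them. *)
Lemma ratio_I_le (R : realType) (z : R) (m : nat) : 0 < z ->
  ratio_I z m.+1 <= z * expR (z * (pi / 2)) * harmonic m.
Proof.
move=> z0; have H2 := I_cosh_gt0 z m.+1; rewrite /ratio_I doubleS in H2 *.
rewrite ler_pdivrMr//.
have K0 : 0 <= z * expR (z * (pi / 2)) by rewrite mulr_ge0 ?expR_ge0// ltW.
have ic k := integrable_quarter (@continuous_cosh_cos R 0 k).
apply: (@le_trans _ _ (z * expR (z * (pi / 2)) * (I_cosh 0 m.*2 - I_cosh 0 m.*2.+2))).
  have -> : z * expR (z * (pi / 2)) * (I_cosh 0 m.*2 - I_cosh 0 m.*2.+2) =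
      Rintegral (leb R) (quarter R) (fun t => z * expR (z * (pi / 2)) *
        (cosh_cos 0 m.*2 t - cosh_cos 0 m.*2.+2 t)).
    by rewrite RintegralZl ?RintegralB//; exact: integrableRB.
  apply: le_Rintegral => //.
  - exact/integrable_quarter/continuous_sinh_cos.
  - by apply: integrableRZ => //; exact: integrableRB.
  - by move=> t /=; rewrite in_itv/= => tq; exact: sinh_cos_le.
move: (z * expR _) K0 => K K0; rewrite -mulrA ler_wpM2l//.
have := I_cosh_at0_rec R m.*2; have := I_cosh_ge_at0 z m.*2.+2.
have J0 := I_cosh_at0_gt0 R m.+1; rewrite doubleS in J0.
move: (I_cosh 0 m.*2) (I_cosh 0 m.*2.+2) J0 (I_cosh z _) H2 => J J2 J20 I I0 JI.
rewrite -(natr1 m.*2.+1) mulrDl mul1r => h.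
rewrite /harmonic/= ler_pdivlMl//.
apply: le_trans JI.
have : m.+1%:R * (J - J2) <= m.*2.+1%:R * (J - J2).
  rewrite ler_wpM2r//; last by rewrite ler_nat ltnS -addnn leq_addr.
  have : 0 <= m.*2.+1%:R * (J - J2) by rewrite mulrBr; lra.
  by rewrite pmulr_rge0.
by lra.
Qed.

(** The partial sums telescope to the difference of the quotients of index 0 and
m.  The former is computed explicitly and contains coth; the latter tends
to 0. *)
Lemma mittag_leffler (R : realType) (z : R) : 0 < z ->
  \sum_(k < m) 2 * z / ((2 * k.+1%:R) ^+ 2 + z ^+ 2) @[m --> \oo] -->
  pi / 2 * (cosh (z * (pi / 2)) / sinh (z * (pi / 2))) - z^-1.
Proof.
move=> z0.
have S m : \sum_(k < m) 2 * z / ((2 * k.+1%:R) ^+ 2 + z ^+ 2) = ratio_I z 0 - ratio_I z m.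
  elim: m => [|m IH]; first by rewrite big_ord0 subrr.
  by rewrite big_ord_recr/= IH (ratio_I_step z m); ring.
under eq_fun do rewrite S.
have sh0 : sinh (z * (pi / 2)) != 0.
  rewrite gt_eqF// /sinh divr_gt0// subr_gt0 ltr_expR.
  have : 0 < z * (pi / 2) by rewrite !mulr_gt0 ?pi_gt0 ?invr_gt0.
  by lra.
have -> : pi / 2 * (cosh (z * (pi / 2)) / sinh (z * (pi / 2))) - z^-1 = ratio_I z 0 - 0.
  have z1 : z != 0 by rewrite gt_eqF.
  rewrite /ratio_I I_cosh0// I_sinh0// subr0.
  by move: (sinh _) (cosh _) sh0 => a b a0; field; rewrite z1 a0.
apply: cvgB; first exact: cvg_cst.
rewrite -cvg_shiftS.
apply: (@cvg0_squeeze _ _ _ _ (fun m => z * expR (z * (pi / 2)) * harmonic m)).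
  apply: nearW => m; rewrite ger0_norm ?ratio_I_le//.
  by rewrite divr_ge0 ?I_sinh_ge0 ?(ltW z0)// (ltW (I_cosh_gt0 _ _)).
rewrite -[X in _ --> X](mulr0 (z * expR (z * (pi / 2)))).
by apply: cvgM; [exact: cvg_cst|exact: cvg_harmonic].
Qed.

Lemma mittag_leffler_scaled (R : realType) (c x : R) : 0 < c -> 0 < x ->
  \sum_(k < m) x / ((c * k.+1%:R) ^+ 2 + x ^+ 2) @[m --> \oo] -->
  pi / (2 * c) * (cosh (pi * x / c) / sinh (pi * x / c)) - (2 * x)^-1.
Proof.
move=> c0 x0; have z0 : 0 < 2 * x / c by rewrite divr_gt0// mulr_gt0.
have c1 : c != 0 by rewrite gt_eqF.
have x1 : x != 0 by rewrite gt_eqF.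
have E : 2 * x / c * (pi / 2) = pi * x / c by field.
have := mittag_leffler z0; rewrite E => H.
have -> : pi / (2 * c) * (cosh (pi * x / c) / sinh (pi * x / c)) - (2 * x)^-1 =
    c^-1 * (pi / 2 * (cosh (pi * x / c) / sinh (pi * x / c)) - (2 * x / c)^-1).
  by move: (_ / sinh _) => q; field; rewrite x1 c1.
have S m : \sum_(k < m) x / ((c * k.+1%:R) ^+ 2 + x ^+ 2) =
    c^-1 * \sum_(k < m) 2 * (2 * x / c) / ((2 * k.+1%:R) ^+ 2 + (2 * x / c) ^+ 2).
  rewrite mulr_sumr; apply: eq_bigr => k _.
  have D0 : (c * k.+1%:R) ^+ 2 + x ^+ 2 != 0.
    by rewrite gt_eqF// ltr_pwDr ?sqr_ge0// exprn_gt0.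
  move: (k.+1%:R : R) D0 => u D0; field.
  rewrite c1 D0 andbT/=.
  have -> : (2 * u * c) ^+ 2 + (2 * x) ^+ 2 = 4 * ((c * u) ^+ 2 + x ^+ 2) by ring.
  by rewrite mulf_neq0.
under eq_fun do rewrite S.
by apply: cvgM => //; exact: cvg_cst.
Qed.

(** * Sine integrals against 1/(e^(ct) - 1) *)

(** The Bose-Einstein weight, which is the sum of the e^(-kct) for k >= 1. *)
Definition bose (R : realType) (c t : R) : R := (expR (c * t) - 1)^-1.

Lemma bose_den_gt0 (R : realType) (c t : R) : 0 < c -> 0 < t -> 0 < expR (c * t) - 1.
Proof. by move=> c0 t0; rewrite subr_gt0 expR_gt1 mulr_gt0. Qed.

Lemma continuous_bose (R : realType) (c t : R) : 0 < c -> 0 < t -> {for t, continuous (bose c)}.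
Proof.
move=> c0 t0; apply: cvgV; first by rewrite gt_eqF// bose_den_gt0.
apply: cvgB; last exact: cvg_cst.
apply: (@continuous_comp R R R (fun t => c * t) expR); last exact: continuous_expR.
by apply: cvgM; [exact: cvg_cst|exact: cvg_id].
Qed.

Lemma measurable_bose (R : realType) (c : R) : 0 < c -> measurable_fun (pos R) (bose c).
Proof. by move=> c0; apply: measurable_in0y => t; exact: continuous_bose. Qed.

(** The right-hand side absorbs the simple pole of the weight at 0 and keeps half
of its exponential decay at infinity; it amounts to u <= e^u - e^(-u) at
u = ct/2. *)
Lemma bose_le (R : realType) (c t : R) : 0 < c -> 0 < t ->
  t * bose c t <= 2 / c * expR (- (c / 2 * t)).
Proof.
move=> c0 t0; rewrite /bose ler_pdivrMr ?bose_den_gt0//.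
have h0 : 0 < c / 2 * t by rewrite mulr_gt0// divr_gt0.
have -> : expR (c * t) = expR (c / 2 * t) * expR (c / 2 * t) by rewrite -expRD; congr expR; lra.
have h1 := expR_ge1Dx (c / 2 * t).
rewrite expRN; have e0 := expR_gt0 (c / 2 * t).
set e := expR _ in h1 e0 *.
have -> : 2 / c / e * (e * e - 1) = 2 / c * (e - e^-1) by field; rewrite !gt_eqF.
have h2 : e^-1 <= 1 by rewrite invf_le1//; lra.
have : 2 / c * (c / 2 * t) <= 2 / c * (e - e^-1).
  by rewrite ler_pM2l ?divr_gt0//; lra.
by rewrite (_ : 2 / c * (c / 2 * t) = t)//; field; rewrite gt_eqF.
Qed.

Lemma integrable_bose (R : realType) (c : R) (n : nat) : 0 < c ->
  integrableR (pos R) (fun t => t ^+ n.+1 * bose c t).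
Proof.
move=> c0; have c2 : 0 < c / 2 by rewrite divr_gt0.
apply: (le_integrableR _ _ _ (integrableRZ (2 / c) _
  (@integrable_pow_exp R n.+1%:R (c / 2) (ltr0Sn _ _) c2))) => //.
  by apply: measurable_funM; [exact: measurable_funX|exact: measurable_bose].
move=> t; rewrite set_itv0y => t0; rewrite ger0_norm; last first.
  by rewrite mulr_ge0 ?exprn_ge0 ?(ltW t0)// invr_ge0 ltW// bose_den_gt0.
have pE : n.+1%:R - 1 = n%:R :> R by rewrite -natr1 addrK.
rewrite exprSr -mulrA /pow_exp pE powR_mulrn ?(ltW t0)// [leRHS]mulrCA.
by rewrite ler_wpM2l ?exprn_ge0 ?(ltW t0)// bose_le.
Qed.

Lemma abs_sin_le (R : realType) (u : R) : 0 <= u -> `|sin u| <= u.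
Proof.
rewrite le_eqVlt => /predU1P[<-|u0]; first by rewrite sin0 normr0.
have [d _ /=] : exists2 d, d \in `]0, u[ & sin u - sin 0 = cos d * (u - 0).
  apply: (@MVT R (@sin R) (@cos R) 0 u u0).
  apply: continuous_subspaceT; exact: continuous_sin.
rewrite sin0 !subr0 => ->; rewrite normrM (gtr0_norm u0).
by rewrite ler_piMl ?(ltW u0)// cos_max.
Qed.

Lemma geometric_bose (R : realType) (c t : R) (N : nat) : 0 < c -> 0 < t ->
  \sum_(k < N) expR (- (c * k.+1%:R * t)) = (1 - expR (- (c * t)) ^+ N) * bose c t.
Proof.
move=> c0 t0; have D := bose_den_gt0 c0 t0.
elim: N => [|N IH]; first by rewrite big_ord0 expr0 subrr mul0r.
rewrite big_ord_recr/= IH.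
have -> : - (c * N.+1%:R * t) = N.+1%:R * (- (c * t)) by ring.
rewrite expRM_natl exprS expRN /bose.
have e0 := expR_gt0 (c * t).
move: (expR _) D e0 => e D e0; move: (_ ^+ N) => q; field.
by rewrite !gt_eqF.
Qed.

(** The geometric series is integrated term by term against the sine.  Its partial
sums are dominated by the weight itself, and |sin (xt)| <= xt cancels the
pole of the weight at 0. *)
Lemma Rintegral_sin_bose_coth (R : realType) (c x : R) : 0 < c -> 0 < x ->
  integrableR (pos R) (fun t => sin (x * t) * bose c t) /\
  Rintegral (leb R) (pos R) (fun t => sin (x * t) * bose c t) =
    pi / (2 * c) * (cosh (pi * x / c) / sinh (pi * x / c)) - (2 * x)^-1.
Proof.
move=> c0 x0.
pose f N t := \sum_(k < N) (expR (- (c * k.+1%:R * t)) * sin (t * x)).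
have ck (k : nat) : 0 < c * k.+1%:R by rewrite mulr_gt0.
have if_ (k : nat) : integrableR (pos R) (fun t => expR (- (c * k.+1%:R * t)) * sin (t * x)).
  exact: (integrable_damped _ (ck k) (@continuous_sin R) (@sin_max R)).
have fS N : f N.+1 = (fun t => f N t + expR (- (c * N.+1%:R * t)) * sin (t * x)).
  by apply/funext => t; rewrite /f big_ord_recr.
have fi N : integrableR (pos R) (f N) /\
    Rintegral (leb R) (pos R) (f N) = \sum_(k < N) x / ((c * k.+1%:R) ^+ 2 + x ^+ 2).
  elim: N => [|N [IH1 IH2]].
    have -> : f 0%N = cst 0 by apply/funext => t; rewrite /f big_ord0.
    by rewrite big_ord0 Rintegral_cst ?mul0r//; split => //; exact: integrable0.
  rewrite fS; split; first exact: integrableRD.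
  by rewrite RintegralD// IH2 big_ord_recr/= Rintegral_expN_sin.
have fE N t : 0 < t -> f N t = (1 - expR (- (c * t)) ^+ N) * bose c t * sin (x * t).
  by move=> t0; rewrite /f -mulr_suml geometric_bose// (mulrC x).
have b0 t : 0 < t -> 0 <= bose c t by move=> t0; rewrite invr_ge0 ltW// bose_den_gt0.
have [i1 c1] : integrableR (pos R) (fun t => sin (x * t) * bose c t) /\
    Rintegral (leb R) (pos R) (f N) @[N --> \oo] -->
    Rintegral (leb R) (pos R) (fun t => sin (x * t) * bose c t).
  apply: (Rdominated_cvg _ _ _ (integrableRZ x _ (@integrable_bose R c 0 c0))) => //.
  - by move=> N; exact: measurable_integrableR (fi N).1.
  - move=> t; rewrite set_itv0y => t0.
    under eq_fun do rewrite (fE _ _ t0).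
    have : (1 - expR (- (c * t)) ^+ N) * bose c t * sin (x * t) @[N --> \oo] -->
        (1 - 0) * bose c t * sin (x * t).
      apply: cvgM; last exact: cvg_cst; apply: cvgM; last exact: cvg_cst.
      apply: cvgB; first exact: cvg_cst.
      by apply: cvg_expr; rewrite ger0_norm ?expR_ge0// expR_lt1 oppr_lt0 mulr_gt0.
    by rewrite subr0 mul1r [X in _ --> X]mulrC.
  - move=> N t; rewrite set_itv0y => t0; rewrite (fE _ _ t0) !normrM expr1.
    rewrite (ger0_norm (b0 _ t0)).
    have e1 : expR (- (c * t)) ^+ N <= 1.
      by rewrite exprn_ile1 ?expR_ge0// expR_le1 oppr_le0 mulr_ge0// ltW.
    have e0 : 0 <= expR (- (c * t)) ^+ N by rewrite exprn_ge0 ?expR_ge0.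
    have -> : x * (t * bose c t) = 1 * bose c t * (x * t) by ring.
    have a1 : `|1 - expR (- (c * t)) ^+ N| <= 1 by rewrite ger0_norm; lra.
    have a2 : `|sin (x * t)| <= x * t by rewrite abs_sin_le// mulr_ge0// ltW.
    by apply: ler_pM => //; [rewrite mulr_ge0// b0|rewrite ler_wpM2r// b0].
split=> //.
have {}c1 : \sum_(k < N) x / ((c * k.+1%:R) ^+ 2 + x ^+ 2) @[N --> \oo] -->
    Rintegral (leb R) (pos R) (fun t => sin (x * t) * bose c t).
  by apply: cvg_trans c1; apply: near_eq_cvg; apply: nearW => N; rewrite (fi N).2.
rewrite -(cvg_lim _ c1)//; exact: (cvg_lim _ (mittag_leffler_scaled c0 x0)).
Qed.

(** * Differentiation in x *)

(** The phase shifts by pi/2 with each n because d/dx sin = sin (. + pi/2), so that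
osc n.+1 is the derivative of osc n in x. *)
Definition osc (R : realType) (w : R -> R) (n : nat) (x t : R) : R :=
  sin (x * t + pi * n%:R / 2) * (t ^+ n * w t).

(** For n = 0 the power t^n does not compensate a pole of w at 0, and the factor
sin (xt) does it instead. *)
Lemma integrable_osc (R : realType) (w : R -> R) (n : nat) (x : R) : 0 <= x ->
  measurable_fun (pos R) w ->
  (forall k, integrableR (pos R) (fun t => t ^+ k.+1 * w t)) ->
  integrableR (pos R) (osc w n x).
Proof.
move=> x0 mw iw.
have mosc : measurable_fun (pos R) (osc w n x).
  apply: measurable_funM; last by apply: measurable_funM => //; exact: measurable_funX.
  apply: (@measurableT_comp _ _ _ _ _ _ (@sin R)).
    by apply: continuous_measurable_fun; exact: continuous_sin.
  by apply: measurable_funD => //; apply: measurable_funM.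
case: n mosc => [|n] mosc.
  apply: (le_integrableR _ mosc _ (integrableRZ x _ (integrable_norm (iw 0%N)))) => //.
  move=> t; rewrite set_itv0y => t0 /=.
  rewrite /osc mulr0 mul0r addr0 expr0 mul1r expr1 !normrM mulrA (gtr0_norm t0).
  by rewrite ler_wpM2r// abs_sin_le// mulr_ge0// ltW.
apply: (le_integrableR _ mosc _ (integrable_norm (iw n))) => // t _ /=.
by rewrite /osc normrM ler_piMl// sin_max.
Qed.

Lemma is_derive_osc (R : realType) (w : R -> R) (n : nat) (x t : R) :
  is_derive x 1 (fun y => osc w n y t) (osc w n.+1 x t).
Proof.
rewrite /osc; set c := t ^+ n * w t.
apply: is_derive_eq; rewrite /GRing.scale/= -(natr1 n).
have -> : x * t + pi * (n%:R + 1) / 2 = x * t + pi * n%:R / 2 + pi / 2 :> R by lra.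
by rewrite sinDpihalf exprS /c; ring.
Qed.

(** The derivative under the integral sign is dominated by t^(n+1) |w(t)|,
uniformly in x. *)
Lemma is_derive_Rintegral_osc (R : realType) (w : R -> R) (n : nat) (x : R) : 0 < x ->
  measurable_fun (pos R) w ->
  (forall k, integrableR (pos R) (fun t => t ^+ k.+1 * w t)) ->
  is_derive x 1 (fun y => Rintegral (leb R) (pos R) (osc w n y))
    (Rintegral (leb R) (pos R) (osc w n.+1 x)).
Proof.
move=> x0 mw iw.
have mD : measurable (pos R : set (measurableTypeR R)) by exact: measurable_itv.
(* Any bounded open interval around x inside the half-line serves. *)
have Ix : `]0, x + 1[%classic x by rewrite /= in_itv/= x0 ltrDl ltr01.
have intf (y : R) : `]0, x + 1[%classic y -> integrableR (pos R) (osc w n y).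
  by rewrite /= in_itv/= => /andP[y0 _]; apply: integrable_osc => //; exact: ltW.
have derf (y t : R) : `]0, x + 1[%classic y -> pos R t -> derivable (fun z => osc w n z t) y 1.
  by move=> _ _; have [] := is_derive_osc w n y t.
have dE (y t : R) : partial1of2 (osc w n) y t = osc w n.+1 y t.
  by rewrite partial1of2E; have [_ ->] := is_derive_osc w n y t.
pose G t := `|t ^+ n.+1 * w t|.
have G_ub (y t : R) : `]0, x + 1[%classic y -> pos R t -> `|partial1of2 (osc w n) y t| <= G t.
  by move=> _ _; rewrite dE /osc normrM ler_piMl// sin_max.
have G0 t : 0 <= G t by exact: normr_ge0.
have iG : integrableR (pos R) G by exact: integrable_norm (iw n).
have dv := derivable_under_integral mD Ix intf derf G0 iG G_ub.
have dI := differentiation_under_integral mD Ix intf derf G0 iG G_ub.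
apply: DeriveDef; first exact: dv.
rewrite -derive1E dI; apply: eq_Rintegral => t _; exact: dE.
Qed.

(** The functions g k = k! (1 + z) z^k satisfy g_k' = - (k g_k + g_(k+1)) along the
flow z' = - z (1 + z), and [stirling2_sumS] reads this as the step from n to
n + 1. *)
Lemma is_derive_geom (R : realType) (z : R -> R) (n : nat) (x : R) :
  is_derive x 1 z (- (z x * (1 + z x))) ->
  is_derive x 1 (fun y => (1 + z y) * (geom_poly n 1).[z y])
    (- ((1 + z x) * (geom_poly n.+1 1).[z x])).
Proof.
move=> dz.
pose g k y := k`!%:R * (1 + z y) * z y ^+ k : R.
have gE m : (fun y => (1 + z y) * (geom_poly m 1).[z y]) =
    (fun y => \sum_(k < m.+1) (stirling2 m k)%:R * g k y).
  apply/funext => y; rewrite geom_poly1 mulr_sumr; apply: eq_bigr => k _.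
  by rewrite /g natrM; ring.
have dg k : is_derive x 1 (g k) (- (k%:R * g k x + g k.+1 x)).
  have du : is_derive x 1 (fun y => 1 + z y) (- (z x * (1 + z x))).
    have := is_deriveD (is_derive_cst (1 : R) x (1 : R)) dz; rewrite add0r; exact.
  case: k => [|k].
    have -> : g 0%N = (fun y => 1 + z y).
      by apply/funext => y; rewrite /g mul1r expr0 mulr1.
    by rewrite mul0r add0r /g mul1r expr1 mulrC.
  have dX : is_derive x 1 (fun y => z y ^+ k.+1)
      (k.+1%:R * z x ^+ k * - (z x * (1 + z x))).
    have := @is_deriveX R R z k.+1 x 1 _ dz; rewrite exprfctE; exact.
  have dM : is_derive x 1 (fun y => (1 + z y) * z y ^+ k.+1)
      ((1 + z x) * (k.+1%:R * z x ^+ k * - (z x * (1 + z x))) +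
       z x ^+ k.+1 * - (z x * (1 + z x))) by exact: is_deriveM du dX.
  have -> : - (k.+1%:R * g k.+1 x + g k.+2 x) =
      k.+1`!%:R * ((1 + z x) * (k.+1%:R * z x ^+ k * - (z x * (1 + z x))) +
       z x ^+ k.+1 * - (z x * (1 + z x))).
    rewrite /g (factS k.+1) natrM !exprS -(natr1 k.+1).
    by move: (k.+1%:R : R) (k.+1`!%:R : R) => a b; ring.
  have -> : g k.+1 = (fun y => k.+1`!%:R * ((1 + z y) * z y ^+ k.+1)).
    by apply/funext => y; rewrite /g mulrA.
  exact: is_deriveZ dM.
have -> : (1 + z x) * (geom_poly n.+1 1).[z x] =
    \sum_(k < n.+2) (stirling2 n.+1 k)%:R * g k x.
  exact: (congr1 (fun h => h x) (gE n.+1)).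
rewrite gE (stirling2_sumS (fun k => g k x)) -sumrN.
have -> : (fun y => \sum_(k < n.+1) (stirling2 n k)%:R * g k y) =
    \sum_(k < n.+1) (fun y => (stirling2 n k)%:R * g k y).
  by apply/funext => y; rewrite fct_sumE.
apply: is_derive_sum => k.
by rewrite -mulrN; apply: is_deriveZ.
Qed.

(** * The two real integral formulas *)

(** Both sides of the case n are differentiated: the left side by
[is_derive_geom], the elementary term p by its own hypothesis, and the integral
by [is_derive_Rintegral_osc].  Hence only n = 0 has to be known, but for all
x > 0. *)
Lemma geom_poly_osc_integral (R : realType) (z : R -> R) (p : nat -> R -> R) (w : R -> R) (A : R) :
  (forall x : R, 0 < x -> is_derive x 1 z (- (z x * (1 + z x)))) ->
  (forall n (x : R), 0 < x -> is_derive x 1 (p n) (- p n.+1 x)) ->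
  measurable_fun (pos R) w ->
  (forall k, integrableR (pos R) (fun t => t ^+ k.+1 * w t)) ->
  (forall x : R, 0 < x -> 1 + z x = p 0%N x + A * Rintegral (leb R) (pos R) (osc w 0 x)) ->
  forall n (x : R), 0 < x ->
  (1 + z x) * (geom_poly n 1).[z x] =
  p n x + A * ((- 1) ^+ n * Rintegral (leb R) (pos R) (osc w n x)).
Proof.
move=> dz dp mw iw base; elim=> [|n IH] x x0.
  by rewrite geom_poly1 big_ord1 /= mul1r expr0 mulr1 mul1r base.
have dL := is_derive_geom n (dz x x0).
have dphi := is_derive_Rintegral_osc n x0 mw iw.
pose F y := Rintegral (leb R) (pos R) (osc w n y).
have dF : is_derive x 1 F (Rintegral (leb R) (pos R) (osc w n.+1 x)) by [].
have dR : is_derive x 1 (fun y => p n y + A * ((- 1) ^+ n * F y))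
    (- p n.+1 x + A * ((- 1) ^+ n * Rintegral (leb R) (pos R) (osc w n.+1 x))).
  exact: is_deriveD (dp n x x0) (is_deriveZ A (is_deriveZ ((-1) ^+ n) dF)).
have E : {near x, (fun y => p n y + A * ((- 1) ^+ n * F y)) =1
    (fun y => (1 + z y) * (geom_poly n 1).[z y])}.
  by near=> y; rewrite IH//; near: y; exact: lt_nbhsr.
have [_ vL] := dL.
have [_ vR] := near_eq_is_derive E dR.
move: vL; rewrite vR => /(congr1 -%R); rewrite opprK => <-.
rewrite exprS; ring.
Unshelve. all: by end_near. Qed.

(** This form shows coth x as 1 + 2z with z = 1/(e^(2x) - 1), hence links
[mittag_leffler] to the argument of the geometric polynomials. *)
Lemma coth_expR (R : realType) (u : R) : 0 < u ->
  cosh u / sinh u = 1 + 2 * (expR (2 * u) - 1)^-1.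
Proof.
move=> u0; have e0 := expR_gt0 u.
have e1 : 0 < expR u - 1 by rewrite subr_gt0 expR_gt1.
rewrite /cosh /sinh expRN (_ : 2 * u = u + u) ?expRD; last by ring.
move: (expR u) e0 e1 => e e0 e1.
have e2 : 0 < e * e - 1 by nra.
have e3 : e - e^-1 != 0.
  have -> : e - e^-1 = (e * e - 1) / e by field; rewrite gt_eqF.
  by rewrite gt_eqF// divr_gt0.
by field; rewrite ?e3 !gt_eqF//.
Qed.

Lemma Rintegral_osc0_bose (R : realType) (c x : R) : 0 < c -> 0 < x ->
  integrableR (pos R) (osc (bose c) 0 x) /\
  Rintegral (leb R) (pos R) (osc (bose c) 0 x) =
    pi / (2 * c) * (1 + 2 * bose (2 * pi / c) x) - (2 * x)^-1.
Proof.
move=> c0 x0.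
have E : osc (bose c) 0 x = (fun t => sin (x * t) * bose c t).
  by apply/funext => t; rewrite /osc mulr0 mul0r addr0 expr0 mul1r.
rewrite E; have [i ->] := Rintegral_sin_bose_coth c0 x0; split=> //.
rewrite coth_expR ?divr_gt0 ?mulr_gt0 ?pi_gt0//.
by rewrite /bose (_ : 2 * pi / c * x = 2 * (pi * x / c))//; field; rewrite gt_eqF.
Qed.

(** The identity 2u/(u^2 - 1) = 2/(u - 1) - 2/(u^2 - 1) at u = e^(pi t) reduces
the weight 1/sinh to two Bose weights. *)
Lemma inv_sinh_bose (R : realType) (t : R) : 0 < t ->
  (sinh (pi * t))^-1 = 2 * bose pi t - 2 * bose (2 * pi) t.
Proof.
move=> t0; have u0 : 0 < pi * t by rewrite mulr_gt0// pi_gt0.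
have e0 := expR_gt0 (pi * t).
have e1 := bose_den_gt0 (pi_gt0 R) t0.
rewrite /bose /sinh expRN (_ : 2 * pi * t = pi * t + pi * t) ?expRD; last by ring.
move: (expR (pi * t)) e0 e1 => e e0 e1.
have e2 : 0 < e * e - 1 by nra.
have e3 : e - e^-1 != 0.
  have -> : e - e^-1 = (e * e - 1) / e by field; rewrite gt_eqF.
  by rewrite gt_eqF// divr_gt0.
by field; rewrite ?e3 !gt_eqF//.
Qed.

(** The elementary terms p n are the iterates under - d/dx of 1/2 + 1/x, the part of
1 + z that the integral does not produce: 1 + z = 1/2 + coth (x/2)/2. *)
Lemma geom_poly_bose_integral (R : realType) (x : R) (n : nat) : 0 < x ->
  (1 + 1 / (expR x - 1)) * (geom_poly n 1).[1 / (expR x - 1)] =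
  (n == 0%N)%:R / 2 + n`!%:R / x ^+ n.+1 +
  2 * ((- 1) ^+ n * Rintegral (leb R) (pos R) (osc (bose (2 * pi)) n x)).
Proof.
have p2 : 0 < 2 * pi :> R by rewrite mulr_gt0// pi_gt0.
move: n x; apply: (@geom_poly_osc_integral R (fun x => 1 / (expR x - 1))
  (fun n x => (n == 0%N)%:R / 2 + n`!%:R / x ^+ n.+1)).
- move=> x x0; have e1 : expR x - 1 != 0 by rewrite gt_eqF// subr_gt0 expR_gt1.
  have d : is_derive x 1 (fun y : R => expR y - 1) (expR x).
    by apply: is_derive_eq; rewrite oppr0 addr0.
  have -> : (fun x : R => 1 / (expR x - 1)) = (fun x => (expR x - 1)^-1).
    by apply/funext => y; rewrite div1r.
  have -> : - (1 / (expR x - 1) * (1 + 1 / (expR x - 1))) = - (expR x - 1) ^- 2 *: expR x.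
    by rewrite /GRing.scale/=; field.
  exact: (@is_deriveV _ (fun y : R => expR y - 1) _ _ _ e1 d).
- move=> n x x0; have x1 : x ^+ n.+1 != 0 by rewrite gt_eqF// exprn_gt0.
  have dX : is_derive x 1 (fun y : R => y ^+ n.+1) (n.+1%:R * x ^+ n).
    by have := @is_deriveX R R id n.+1 x 1 _ (is_derive_id x 1); rewrite exprfctE /GRing.scale/= mulr1.
  have dV := @is_deriveV _ (fun y : R => y ^+ n.+1) _ _ _ x1 dX.
  have -> : - ((n.+1 == 0%N)%:R / 2 + n.+1`!%:R / x ^+ n.+2) =
      0 + n`!%:R *: (- (x ^+ n.+1) ^- 2 *: (n.+1%:R * x ^+ n)) :> R.
    rewrite /GRing.scale/= mul0r factS natrM !exprS.
    by have := expf_neq0 n (lt0r_neq0 x0); move: (x ^+ n) => y y0; field; rewrite y0 gt_eqF.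
  exact: is_deriveD (is_derive_cst _ x 1) (is_deriveZ n`!%:R dV).
- exact: measurable_bose.
- by move=> k; exact: integrable_bose.
move=> x x0; rewrite (Rintegral_osc0_bose p2 x0).2 fact0 expr1 eqxx /bose.
have pp : pi != 0 :> R by rewrite gt_eqF// pi_gt0.
have -> : 2 * pi / (2 * pi) = 1 :> R by rewrite divff// gt_eqF.
rewrite !mul1r; have e1 : expR x - 1 != 0 by rewrite gt_eqF// subr_gt0 expR_gt1.
by move: (pi : R) pp => q pp; field; rewrite pp e1 gt_eqF.
Qed.

(** At n = 0 the integral is coth x - coth (x/2)/2 = tanh (x/2)/2, and 1 + z is
1/2 + tanh (x/2)/2; the constant 1/2 disappears with the first derivative. *)
Lemma geom_poly_sinh_integral (R : realType) (x : R) (n : nat) : 0 < x ->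
  let w := fun t : R => (sinh (pi * t))^-1 in
  integrableR (pos R) (osc w n x) /\
  (1 + - 1 / (expR x + 1)) * (geom_poly n 1).[- 1 / (expR x + 1)] =
  (n == 0%N)%:R / 2 + 1 * ((- 1) ^+ n * Rintegral (leb R) (pos R) (osc w n x)).
Proof.
move=> x0 w.
have p1 : 0 < pi :> R by exact: pi_gt0.
have p2 : 0 < 2 * pi :> R by rewrite mulr_gt0.
have wE t : pos R t -> w t = 2 * bose pi t - 2 * bose (2 * pi) t.
  by rewrite set_itv0y; exact: inv_sinh_bose.
have mw : measurable_fun (pos R) w.
  apply: (@eq_measurable_fun _ _ _ _ _ (fun t => 2 * bose pi t - 2 * bose (2 * pi) t)).
    by move=> t /[!inE] /wE.
  by apply: measurable_funB; apply: measurable_funM => //; exact: measurable_bose.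
have iw k : integrableR (pos R) (fun t => t ^+ k.+1 * w t).
  apply: (@eq_integrableR R _
    (fun t => 2 * (t ^+ k.+1 * bose pi t) - 2 * (t ^+ k.+1 * bose (2 * pi) t))) => //.
    by move=> t /wE ->; ring.
  by apply: integrableRB => //; apply: integrableRZ => //; exact: integrable_bose.
split; first by apply: integrable_osc => //; exact: ltW.
move: n x x0; apply: (@geom_poly_osc_integral R (fun x => - 1 / (expR x + 1))
  (fun n x => (n == 0%N)%:R / 2)) => //.
- move=> x x0; have e1 : expR x + 1 != 0 by rewrite gt_eqF// addr_gt0// expR_gt0.
  have d : is_derive x 1 (fun y : R => expR y + 1) (expR x).
    by apply: is_derive_eq; rewrite addr0.
  have -> : - (- 1 / (expR x + 1) * (1 + - 1 / (expR x + 1))) =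
      (- 1) *: (- (expR x + 1) ^- 2 *: expR x) by rewrite /GRing.scale/=; field.
  have dV := @is_deriveV _ (fun y : R => expR y + 1) _ _ _ e1 d.
  exact: (is_deriveZ (- 1 : R) dV).
- by move=> n x x0; rewrite mul0r oppr0; exact: is_derive_cst.
move=> x x0.
have [i1 v1] := Rintegral_osc0_bose p1 x0.
have [i2 v2] := Rintegral_osc0_bose p2 x0.
have -> : Rintegral (leb R) (pos R) (osc w 0 x) = Rintegral (leb R) (pos R)
    (fun t => 2 * osc (bose pi) 0 x t - 2 * osc (bose (2 * pi)) 0 x t).
  by apply: eq_Rintegral => t /[!inE] /wE; rewrite /osc => ->; ring.
rewrite RintegralB ?RintegralZl ?v1 ?v2 => //; [|exact: integrableRZ|exact: integrableRZ].
have pp : pi != 0 :> R by rewrite gt_eqF.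
rewrite /bose.
have -> : 2 * pi / (2 * pi) = 1 :> R by rewrite divff// gt_eqF.
have -> : 2 * pi / pi = 2 :> R by rewrite mulfK.
rewrite !mul1r (_ : 2 * x = x + x) ?expRD; last by ring.
have e1 : 0 < expR x - 1 by rewrite subr_gt0 expR_gt1.
move: (expR x) e1 => e e1; clear -x0 e1 pp.
have e2 : 0 < e * e - 1 by nra.
have e3 : 0 < e + 1 by lra.
have x2 : 0 < x + x by rewrite addr_gt0.
by move: (pi : R) pp => q pp; field; rewrite pp !gt_eqF.
Qed.

(** * The three representations *)

(* In the second clause the term (n == 0)%:R vanishes for n >= 1; for n = 0 it
   is the k = 0 term of sum_(k >= 0) k^n e^(-kx) (with 0^0 = 1), which the left
   hand side contains and the integral does not. *)
Theorem proposition16 (R : realType) :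
  (forall (r x : R) (n : nat) (a : R),
     0 <= r -> 0 < x -> x < 1 -> 0 < a -> a < 1 ->
     let F := fun s : R[i] =>
       cpow x (- s) * s ^+ n * GammaC s * GammaC ((r + 1)%:C - s) in
     vline_integrable a F /\
     (((1 + x) `^ (r + 1))^-1 * (geom_poly n (r + 1)).[- x / (1 + x)])%:C =
     (- 1) ^+ n / (2 * pi%:C * 'i * (GammaR (r + 1))%:C) * vline_integral a F)
  /\
  (forall (x : R) (n : nat) (a : R),
     0 < x -> n%:R + 1 < a ->
     let F := fun s : R[i] => cpow x (- s) * zetaC (s - n%:R) * GammaC s in
     vline_integrable a F /\
     (expR x / (expR x - 1) * (geom_poly n 1).[1 / (expR x - 1)])%:C =
     (n == 0%N)%:R + (2 * pi%:C * 'i)^-1 * vline_integral a F)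
  /\
  (forall (x : R) (n : nat),
     0 < x -> (1 <= n)%N ->
     let F := fun t : R =>
       sin (x * t + pi * n%:R / 2) * (t ^+ n / sinh (pi * t)) in
     let G := fun t : R =>
       sin (x * t + pi * n%:R / 2) * (t ^+ n / (expR (2 * pi * t) - 1)) in
     [/\ (@lebesgue_measure R).-integrable `]0, +oo[ (EFin \o F),
         expR x / (expR x + 1) * (geom_poly n 1).[- 1 / (expR x + 1)] =
         (- 1) ^+ n * Rintegral (@lebesgue_measure R) `]0, +oo[ F,
         (@lebesgue_measure R).-integrable `]0, +oo[ (EFin \o G) &
         expR x / (expR x - 1) * (geom_poly n 1).[1 / (expR x - 1)] =
         n`!%:R / x ^+ n.+1 +
         2 * (- 1) ^+ n * Rintegral (@lebesgue_measure R) `]0, +oo[ G]).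
Proof.
split; [|split].
- by move=> r x n a r0 x0 _ a0 a1; exact: geom_poly_Gamma_integral.
- by move=> x n a x0 na; exact: geom_poly_zeta_integral.
move=> x n x0 n0 F G.
(* For n >= 1 the constant 1/2, present only at n = 0, drops out. *)
have nE : (n == 0%N) = false by rewrite eqn0Ngt n0.
have p2 : 0 < 2 * pi :> R by rewrite mulr_gt0// pi_gt0.
have [iF eF] := geom_poly_sinh_integral n x0.
have eG := geom_poly_bose_integral n x0.
have e0 := expR_gt0 x.
have e1 : expR x - 1 != 0 by rewrite gt_eqF// subr_gt0 expR_gt1.
have e2 : expR x + 1 != 0 by rewrite gt_eqF// addr_gt0.
split.
- exact: iF.
- have -> : expR x / (expR x + 1) = 1 + - 1 / (expR x + 1) by field.
  by rewrite eF nE mul0r add0r mul1r.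
- apply: (@integrable_osc R (bose (2 * pi)) n x (ltW x0)); first exact: measurable_bose.
  by move=> k; exact: integrable_bose.
- have -> : expR x / (expR x - 1) = 1 + 1 / (expR x - 1) by field.
  by rewrite eG nE mul0r add0r mulrA.
Qed.
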